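(* Let $\Gamma$ be a finite group, $G$ a graph, $T$ a graph with a right $\Gamma$-action, and $P$ a finite poset with a free left $\Gamma$-action. Let $d$ be the minimal diameter of a spanning tree of $G$. If the induced action of $\Gamma$ on the graph $P^1$ is $\max\{5,d+2\}$-discontinuous, then there is a natural homotopy equivalence \[\bigl|\mathrm{Hom}(G, T\times_\Gamma P^1)\bigr| \simeq \bigl|\mathrm{Hom}(G, T)\bigr|\times_\Gamma \bigl|\mathrm{Hom}(G, P^1)\bigr|.\]
   Context: Graphs are finite, undirected, without multiple edges, loops allowed; $u\sim v$ denotes adjacency. The product $G\times H$ has vertex set $V(G)\times V(H)$ with $(g,h)\sim(g',h')$ iff $g\sim g'$ and $h\sim h'$. $\mathrm{Hom}(G,H)$ is the poset of all maps $\alpha\colon V(G)\to 2^{V(H)}\setminus\{\emptyset\}$ such that whenever $g\sim g'$ in $G$, every element of $\alpha(g)$ is adjacent to every element of $\alpha(g')$; ordered by $\alpha\le\beta$ iff $\alpha(g)\subseteq\beta(g)$ for all $g$. $|Q|$ denotes the geometric realization of the order complex of a poset $Q$. A right (resp. left) $\Gamma$-action on $H$ induces a right (resp. left) action on $\mathrm{Hom}(G,H)$ by applying the group element elementwise to each $\alpha(g)$. For a poset $P$, $P^1$ is the reflexive graph whose vertices are the atoms of $P$, with $x\sim y$ iff there is $z\in P$ with $z\ge x$, $z\ge y$. If $T$ has a right and $H$ a left $\Gamma$-action, $T\times_\Gamma H$ is the graph on the equivalence classes of $V(T)\times V(H)$ under $(t\gamma,h)\sim(t,\gamma h)$, with $[(t,h)]\sim[(t',h')]$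 iff some representatives are adjacent in $T\times H$. For spaces $X$ (right action) and $Y$ (left action), $X\times_\Gamma Y$ is the quotient of $X\times Y$ by $(x\gamma,y)\sim(x,\gamma y)$. A left $\Gamma$-action on a graph $H$ is $m$-discontinuous ($m>0$ an integer) if for every vertex $v$ and every non-identity $\gamma\in\Gamma$, $\gamma v$ is not at graph distance $\le m-1$ from $v$ (i.e. not in the neighborhood of radius $m-1$ around $v$). The diameter of a tree is the maximal distance in the tree between two of its vertices. *)

(* Defs.v *)
From HB Require Import structures.
From mathcomp Require Import all_boot all_order all_algebra all_fingroup.
From mathcomp Require Import generic_quotient.
From mathcomp Require Import all_classical all_reals topology normedtype.

Set Implicit Arguments.
Unset Strict Implicit.
Unset Printing Implicit Defensive.

Import Order.TTheory GRing.Theory Num.Theory.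
Import numFieldNormedType.Exports.

Local Open Scope classical_set_scope.
Local Open Scope ring_scope.
Local Open Scope quotient_scope.

Record graph := Graph {
  vertex :> finType;
  adj : rel vertex;
  adj_sym : symmetric adj
}.

Record ghom (G H : graph) := GHom {
  ghom_fun :> G -> H;
  ghomP : forall x y, adj x y -> adj (ghom_fun x) (ghom_fun y)
}.

Section GraphProduct.
Variables G H : graph.

Definition gprod_adj : rel (G * H) := fun x y => adj x.1 y.1 && adj x.2 y.2.

Lemma gprod_adj_sym : symmetric gprod_adj.
Proof.
by move=> x y; rewrite /gprod_adj [adj x.1 _]adj_sym [adj x.2 _]adj_sym.
Qed.

Definition gprod := Graph gprod_adj_sym.
End GraphProduct.

Section Metric.
Variables (T : eqType) (e : rel T).

Definition walk (x y : T) (n : nat) : Prop :=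
  exists p : seq T, [/\ path e x p, last x p = y & size p = n].

Definition is_dist (x y : T) (n : nat) : Prop :=
  walk x y n /\ forall k, walk x y k -> (n <= k)%N.

Definition is_diam (d : nat) : Prop :=
  (exists x y, is_dist x y d) /\ (forall x y n, is_dist x y n -> (n <= d)%N).
End Metric.

(* A spanning tree of G is given by its edge relation; [ucycle] also accepts
   the sequence [:: x; y] running back and forth along one edge. *)
Definition spanning_tree (G : graph) (e : rel G) : Prop :=
  [/\ symmetric e, irreflexive e & subrel e (@adj G)] /\
  [/\ (0 < #|G|)%N, forall x y, connect e x y
    & forall c, ucycle e c -> (size c <= 2)%N].

Definition min_spanning_diam (G : graph) (d : nat) : Prop :=
  (exists2 e : rel G, spanning_tree e & is_diam e d) /\
  (forall (e : rel G) k, spanning_tree e -> is_diam e k -> (d <= k)%N).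

(* Right actions are the total actions [{action gT &-> X}] of MathComp. *)
Record left_action (gT : finGroupType) (X : Type) := LeftAction {
  lact :> gT -> X -> X;
  lact1 : forall x, lact 1%g x = x;
  lactM : forall a b x, lact (a * b)%g x = lact a (lact b x)
}.

Section RightAction.
Variables (gT : finGroupType) (X : Type) (r : {action gT &-> X}).

Lemma ractM x (a b : gT) : r x (a * b)%g = r (r x a) b.
Proof.
by have [_ rM] : is_action [set: gT]%SET r by [case: (r)]; apply: rM; rewrite inE.
Qed.

Lemma ract1 x : r x 1%g = x.
Proof.
have [inj _] : is_action [set: gT]%SET r by case: (r).
by apply: (inj 1%g); rewrite -ractM mulg1.
Qed.
End RightAction.

Record right_graph (gT : finGroupType) := RightGraph {
  rgraph_graph :> graph;
  rgraph_act : {action gT &-> rgraph_graph};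
  rgraph_adj : forall a x y,
    adj x y -> adj (rgraph_act x a) (rgraph_act y a)
}.

Record left_graph (gT : finGroupType) := LeftGraph {
  lgraph_graph :> graph;
  lgraph_act : left_action gT lgraph_graph;
  lgraph_adj : forall a x y,
    adj x y -> adj (lgraph_act a x) (lgraph_act a y)
}.

Record right_poset (gT : finGroupType) := RightPoset {
  rposet_disp : Order.disp_t;
  rposet_poset :> finPOrderType rposet_disp;
  rposet_act : {action gT &-> rposet_poset};
  rposet_le : forall a x y,
    (x <= y)%O -> (rposet_act x a <= rposet_act y a)%O
}.

Record left_poset (gT : finGroupType) := LeftPoset {
  lposet_disp : Order.disp_t;
  lposet_poset :> finPOrderType lposet_disp;
  lposet_act : left_action gT lposet_poset;
  lposet_le : forall a x y,
    (x <= y)%O -> (lposet_act a x <= lposet_act a y)%O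
}.

Definition free_action (gT : finGroupType) (X : Type) (l : left_action gT X) : Prop :=
  forall a x, l a x = x -> a = 1%g.

Definition discontinuous (gT : finGroupType) (m : nat) (H : left_graph gT) : Prop :=
  (0 < m)%N /\
  forall (v : H) (a : gT) (n : nat), a != 1%g -> (n <= m.-1)%N ->
    ~ is_dist (@adj H) v (lgraph_act H a v) n.

Record rghom (gT : finGroupType) (T T' : right_graph gT) := RGHom {
  rghom_hom :> ghom T T';
  rghomP : forall x a,
    rghom_hom (rgraph_act T x a) = rgraph_act T' (rghom_hom x) a
}.

Record lghom (gT : finGroupType) (H H' : left_graph gT) := LGHom {
  lghom_hom :> ghom H H';
  lghomP : forall a x,
    lghom_hom (lgraph_act H a x) = lgraph_act H' a (lghom_hom x)
}.

Section Balanced.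
Variables (gT : finGroupType) (X Y : choiceType).
Variables (r : {action gT &-> X}) (l : left_action gT Y).

(* p = (t a, h) and q = (t, a h) for some a; this relation is already an
   equivalence. *)
Definition balanced_rel : rel (X * Y) := fun p q =>
  [exists a : gT, (p.1 == r q.1 a) && (q.2 == l a p.2)].

Lemma balanced_equiv : equiv_class_of balanced_rel.
Proof.
have rM x a b : r x (a * b)%g = r (r x a) b by exact: ractM.
have r1 x : r x 1%g = x by exact: ract1.
split=> [p|p q|q p s].
- by apply/existsP; exists 1%g; rewrite r1 lact1 !eqxx.
- apply/existsP/existsP => -[a /andP[/eqP-> /eqP->]]; exists a^-1%g.
    by rewrite -rM mulgV r1 -lactM mulVg lact1 !eqxx.
  by rewrite -rM mulgV r1 -lactM mulVg lact1 !eqxx.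
- move=> /existsP[a /andP[/eqP ea /eqP fa]] /existsP[b /andP[/eqP eb /eqP fb]].
  apply/existsP; exists (b * a)%g.
  by rewrite rM -eb -ea lactM -fa -fb !eqxx.
Qed.

Canonical balanced_equiv_rel := EquivRelPack balanced_equiv.
End Balanced.

Notation balanced r l := {eq_quot (balanced_equiv_rel r l)}.

Section BalancedGraph.
Variables (gT : finGroupType) (T : right_graph gT) (H : left_graph gT).

Local Notation V := (quot_type (balanced (rgraph_act T) (lgraph_act H))).

Definition gbalanced_adj : rel V := fun c c' =>
  [exists x : gprod T H, exists y : gprod T H,
    [&& \pi_V x == c, \pi_V y == c' & adj x y]].

Lemma gbalanced_adj_sym : symmetric gbalanced_adj.
Proof.
move=> c c'; apply/existsP/existsP => -[x /existsP[y /and3P[ex ey xy]]];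
by exists y; apply/existsP; exists x; rewrite ey ex adj_sym.
Qed.

Definition gbalanced : graph := Graph gbalanced_adj_sym.

Definition gbalanced_pi (x : gprod T H) : gbalanced := \pi_V x.

Lemma gbalanced_piP x y :
  reflect (gbalanced_pi x = gbalanced_pi y)
          (balanced_rel (rgraph_act T) (lgraph_act H) x y).
Proof. exact: eqmodP. Qed.

Lemma gbalanced_adjP (c c' : gbalanced) :
  reflect (exists x y, [/\ gbalanced_pi x = c, gbalanced_pi y = c' & adj x y])
          (adj c c').
Proof.
apply: (iffP existsP) => [[x /existsP[y /and3P[/eqP xc /eqP yc xy]]]|].
  by exists x, y.
move=> [x [y [xc yc xy]]]; exists x; apply/existsP; exists y.
by apply/and3P; split=> //; apply/eqP.
Qed.

Lemma gbalanced_reprK (c : gbalanced) : gbalanced_pi (repr (c : V)) = c.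
Proof. exact: reprK. Qed.
End BalancedGraph.

Section BalancedGraphMap.
Variables (gT : finGroupType) (T T' : right_graph gT) (H H' : left_graph gT).
Variables (v : rghom T T') (w : lghom H H').

Definition gbalanced_fun (c : gbalanced T H) : gbalanced T' H' :=
  let x := repr c in gbalanced_pi (v x.1, w x.2).

Lemma gbalanced_funE t h :
  gbalanced_fun (gbalanced_pi (t, h)) = gbalanced_pi (v t, w h).
Proof.
have /gbalanced_piP/existsP[a /andP[/eqP e1 /eqP /= e2]] :=
  gbalanced_reprK (gbalanced_pi (t, h)).
apply/gbalanced_piP/existsP; exists a => /=.
by rewrite -lghomP -e2 -rghomP -e1 !eqxx.
Qed.

Lemma gbalanced_funP x y :
  adj x y -> adj (gbalanced_fun x) (gbalanced_fun y).
Proof.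
move=> /gbalanced_adjP[[t h] [[t' h'] [<- <- /andP[/= a1 a2]]]].
rewrite !gbalanced_funE; apply/gbalanced_adjP.
by exists (v t, w h), (v t', w h'); split=> //; rewrite /= /gprod_adj /= !ghomP.
Qed.

Definition gbalanced_map := GHom gbalanced_funP.
End BalancedGraphMap.

Section AtomGraph.
Variables (gT : finGroupType) (P : left_poset gT).

(* P is not assumed to have a least element: its atoms are its minimal
   elements. *)
Definition is_atom (x : P) := [forall y : P, (y <= x)%O ==> (y == x)].

Definition atom := {x : P | is_atom x}.

Definition atom_adj : rel atom := fun x y =>
  [exists z : P, (val x <= z)%O && (val y <= z)%O].

Lemma atom_adj_sym : symmetric atom_adj.
Proof. by move=> x y; apply/eq_existsb => z; rewrite andbC. Qed.

Definition atom_graph_graph : graph := Graph atom_adj_sym.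

Lemma is_atom_act a x : is_atom x -> is_atom (lposet_act P a x).
Proof.
move=> /forallP xP; apply/forallP => y; apply/implyP => yx.
have := lposet_le a^-1%g yx; rewrite -lactM mulVg lact1 => yx'.
have /eqP <- := implyP (xP (lposet_act P a^-1%g y)) yx'.
by rewrite -lactM mulgV lact1.
Qed.

Definition atom_act_fun (a : gT) (x : atom) : atom :=
  exist _ (lposet_act P a (val x)) (is_atom_act a (valP x)).

Lemma atom_act1 x : atom_act_fun 1%g x = x.
Proof. by apply: val_inj; rewrite /= lact1. Qed.

Lemma atom_actM a b x :
  atom_act_fun (a * b)%g x = atom_act_fun a (atom_act_fun b x).
Proof. by apply: val_inj; rewrite /= lactM. Qed.

Definition atom_act : left_action gT atom_graph_graph :=
  LeftAction atom_act1 atom_actM.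

Lemma atom_act_adj a (x y : atom_graph_graph) :
  adj x y -> adj (atom_act a x) (atom_act a y).
Proof.
move=> /existsP[z /andP[xz yz]]; apply/existsP; exists (lposet_act P a z).
by rewrite /= !lposet_le.
Qed.

Definition atom_graph : left_graph gT := LeftGraph atom_act_adj.
End AtomGraph.

Fact hom_display : Order.disp_t. Proof. exact: Order.Disp tt tt. Qed.

Section Hom.
Variables G H : graph.

Definition is_multihom (f : {ffun G -> {set H}}) : bool :=
  [forall g, f g != finset.set0] &&
  [forall g, forall g', adj g g' ==>
    [forall h in f g, forall h' in f g', adj h h']].

Record hom := Hom { hom_fun :> {ffun G -> {set H}}; _ : is_multihom hom_fun }.

HB.instance Definition _ := [isSub for hom_fun].
HB.instance Definition _ := [Finite of hom by <:].

Definition hom_le : rel hom := fun f f' => [forall g, f g \subset f' g].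

Lemma hom_le_refl : reflexive hom_le.
Proof. by move=> f; apply/forallP. Qed.

Lemma hom_le_anti : antisymmetric hom_le.
Proof.
move=> f f' /andP[/forallP ff' /forallP f'f]; apply/val_inj/ffunP => g.
by apply/eqP; rewrite finset.eqEsubset ff' f'f.
Qed.

Lemma hom_le_trans : transitive hom_le.
Proof.
move=> f2 f1 f3 /forallP f12 /forallP f23; apply/forallP => g.
exact: fintype.subset_trans (f12 g) (f23 g).
Qed.

HB.instance Definition _ := Order.Le_isPOrder.Build hom_display hom
  hom_le_refl hom_le_anti hom_le_trans.

Lemma homP (f : hom) : is_multihom f. Proof. by case: f. Qed.

Lemma hom_adj (f : hom) g g' h h' :
  adj g g' -> h \in f g -> h' \in f g' -> adj h h'.
Proof.
have /andP[_ /forallP fP] := homP f.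
move=> gg' fgh fg'h'; have /implyP /(_ gg') := forallP (fP g) g'.
by move=> /forallP/(_ h)/implyP/(_ fgh)/forallP/(_ h')/implyP/(_ fg'h').
Qed.

Lemma hom_neq0 (f : hom) g : f g != finset.set0.
Proof. by have /andP[/forallP/(_ g)] := homP f. Qed.

Lemma hom_leP (f f' : hom) :
  reflect (forall g, f g \subset f' g) (f <= f')%O.
Proof. exact: forallP. Qed.
End Hom.

Section HomMap.
Variables (G G' H H' : graph) (u : ghom G' G) (v : ghom H H').

Definition hom_map_fun (f : hom G H) : {ffun G' -> {set H'}} :=
  [ffun g => v @: f (u g)].

Lemma hom_map_subproof f : is_multihom (hom_map_fun f).
Proof.
apply/andP; split; first by apply/forallP=> g; rewrite ffunE imset_eq0 hom_neq0.
apply/forallP => g; apply/forallP => g'; apply/implyP => gg'.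
apply/forallP => h; apply/implyP; rewrite ffunE => /imsetP[x fx ->].
apply/forallP => h'; apply/implyP; rewrite ffunE => /imsetP[x' fx' ->].
by apply/ghomP/(hom_adj (ghomP u gg') fx fx').
Qed.

Definition hom_map (f : hom G H) : hom G' H' := Hom (hom_map_subproof f).

Lemma hom_map_le (f f' : hom G H) :
  (f <= f')%O -> (hom_map f <= hom_map f')%O.
Proof.
by move=> /hom_leP ff'; apply/hom_leP => g; rewrite !ffunE imsetS.
Qed.
HB.instance Definition _ :=
  Order.isOrderMorphism.Build _ _ _ _ hom_map hom_map_le.
End HomMap.

Definition ghom_id (G : graph) : ghom G G := @GHom G G id (fun _ _ => id).

Section HomAction.
Variables (gT : finGroupType) (G : graph).

Section Right.
Variable T : right_graph gT.

Definition ract_ghom (a : gT) : ghom T T := GHom (@rgraph_adj gT T a).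

Definition hom_ract_fun (f : hom G T) (a : gT) : hom G T :=
  hom_map (ghom_id G) (ract_ghom a) f.

Lemma hom_ract1 f : hom_ract_fun f 1%g = f.
Proof.
apply/val_inj/ffunP => g; rewrite ffunE /=.
by under eq_imset => x do rewrite ract1; rewrite imset_id.
Qed.

Lemma hom_ractM f : act_morph hom_ract_fun f.
Proof.
move=> a b; apply/val_inj/ffunP => g; rewrite !ffunE -imset_comp /=.
by apply: eq_imset => x /=; rewrite ractM.
Qed.

Definition hom_ract : {action gT &-> hom G T} :=
  TotalAction hom_ract1 hom_ractM.

Definition hom_rposet : right_poset gT :=
  @RightPoset gT _ (hom G T) hom_ract
    (fun a => @hom_map_le _ _ _ _ (ghom_id G) (ract_ghom a)).
End Right.

Section Left.
Variable H : left_graph gT.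

Definition lact_ghom (a : gT) : ghom H H := GHom (@lgraph_adj gT H a).

Definition hom_lact_fun (a : gT) (f : hom G H) : hom G H :=
  hom_map (ghom_id G) (lact_ghom a) f.

Lemma hom_lact1 f : hom_lact_fun 1%g f = f.
Proof.
apply/val_inj/ffunP => g; rewrite ffunE /=.
by under eq_imset => x do rewrite lact1; rewrite imset_id.
Qed.

Lemma hom_lactM a b f :
  hom_lact_fun (a * b)%g f = hom_lact_fun a (hom_lact_fun b f).
Proof.
apply/val_inj/ffunP => g; rewrite !ffunE -imset_comp /=.
by apply: eq_imset => x /=; rewrite lactM.
Qed.

Definition hom_lact : left_action gT (hom G H) :=
  LeftAction hom_lact1 hom_lactM.

Definition hom_lposet : left_poset gT :=
  @LeftPoset gT _ (hom G H) hom_lact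
    (fun a => @hom_map_le _ _ _ _ (ghom_id G) (lact_ghom a)).
End Left.
End HomAction.

Section Realization.
Variable R : realType.

Section Space.
Variables (d : Order.disp_t) (Q : finPOrderType d).

(* Barycentric coordinates: the support of x is a chain, i.e. a simplex of
   the order complex. *)
Definition realization_set : set {ptws Q -> R} :=
  [set x | [/\ forall q, 0 <= x q, \sum_q x q = 1
             & forall p q, x p != 0 -> x q != 0 -> (p >=< q)%O]].

Definition realization : topologicalType := set_type realization_set.
End Space.

Section Map.
Variables (d d' : Order.disp_t).
Variables (Q : finPOrderType d) (Q' : finPOrderType d').
Variable f : {omorphism Q -> Q'}.

Definition realization_map_fun (x : realization Q) : {ptws Q' -> R} :=
  fun q' => \sum_(q | f q == q') val x q.

Lemma realization_map_subproof x :
  realization_map_fun x \in @realization_set _ Q'.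
Proof.
have [x0 x1 xc] := set_valP x; apply/mem_set; split.
- by move=> q; apply: sumr_ge0 => p _; exact: x0.
- by rewrite -[RHS]x1 (partition_big f xpredT).
- have supp q' : realization_map_fun x q' != 0 ->
      exists2 q, f q = q' & val x q != 0.
    move=> /eqP /psumr_neq0P[q _|q /andP[/eqP fq xq]]; first exact: x0.
    by exists q => //; rewrite gt_eqF.
  move=> p' q' /supp[p <- xp] /supp[q <- xq].
  by case/orP: (xc _ _ xp xq) => /(omorph_le f) le; rewrite /Order.comparable le ?orbT.
Qed.

Definition realization_map (x : realization Q) : realization Q' :=
  exist _ (realization_map_fun x) (realization_map_subproof x).

Lemma realization_mapE x q' :
  val (realization_map x) q' = \sum_(q | f q == q') val x q.
Proof. by []. Qed.
End Map.

Lemma realization_map_id d (Q : finPOrderType d) (f : {omorphism Q -> Q}) :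
  f =1 id -> realization_map f =1 id.
Proof.
move=> fid x; apply/val_inj/funext => q; rewrite realization_mapE.
by under eq_bigl => p do rewrite fid; rewrite big_pred1_eq.
Qed.

Lemma realization_map_comp d d' d'' (Q : finPOrderType d)
    (Q' : finPOrderType d') (Q'' : finPOrderType d'') (f : {omorphism Q -> Q'})
    (g : {omorphism Q' -> Q''}) (h : {omorphism Q -> Q''}) :
  h =1 g \o f -> realization_map h =1 realization_map g \o realization_map f.
Proof.
move=> hE x; apply/val_inj/funext => q; rewrite !realization_mapE.
rewrite (partition_big f (fun q' => g q' == q)) => [|p]; last by rewrite hE.
apply: eq_bigr => q' /eqP gq'; rewrite realization_mapE; apply: eq_bigl => p.
by rewrite hE /= andb_idl // => /eqP->; rewrite gq'.
Qed.

Section Actions.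
Variable gT : finGroupType.

Section Right.
Variable Q : right_poset gT.

Definition rposet_map (a : gT) (q : Q) : Q := rposet_act Q q a.

HB.instance Definition _ a :=
  Order.isOrderMorphism.Build _ _ _ _ (rposet_map a) (@rposet_le gT Q a).

Definition realization_ract_fun (x : realization Q) (a : gT) : realization Q :=
  realization_map (rposet_map a) x.

Lemma realization_ract1 x : realization_ract_fun x 1%g = x.
Proof. by apply: realization_map_id => q; exact: ract1. Qed.

Lemma realization_ractM x : act_morph realization_ract_fun x.
Proof. by move=> a b; apply: realization_map_comp => q; exact: ractM. Qed.

Definition realization_ract : {action gT &-> realization Q} :=
  TotalAction realization_ract1 realization_ractM.
End Right.

Section Left.
Variable Q : left_poset gT.

Definition lposet_map (a : gT) (q : Q) : Q := lposet_act Q a q.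

HB.instance Definition _ a :=
  Order.isOrderMorphism.Build _ _ _ _ (lposet_map a) (@lposet_le gT Q a).

Definition realization_lact_fun (a : gT) (x : realization Q) : realization Q :=
  realization_map (lposet_map a) x.

Lemma realization_lact1 x : realization_lact_fun 1%g x = x.
Proof. by apply: realization_map_id => q; exact: lact1. Qed.

Lemma realization_lactM a b x :
  realization_lact_fun (a * b)%g x
  = realization_lact_fun a (realization_lact_fun b x).
Proof. by apply: realization_map_comp => q; exact: lactM. Qed.

Definition realization_lact : left_action gT (realization Q) :=
  LeftAction realization_lact1 realization_lactM.
End Left.
End Actions.
End Realization.

Section BalancedSpace.
Variables (gT : finGroupType) (X Y : topologicalType).
Variables (r : {action gT &-> X}) (l : left_action gT Y).

Definition balanced_space : topologicalType :=
  quotient_topology (balanced r l).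

Definition balanced_space_pi (x : X) (y : Y) : balanced_space :=
  \pi_(balanced r l) (x, y).
End BalancedSpace.

Section Homotopy.
Variable R : realType.

Definition homotopic (X Y : topologicalType) (f g : X -> Y) : Prop :=
  exists h : X * R -> Y,
    [/\ {within [set z : X * R | 0 <= z.2 <= 1], continuous h},
        forall x, h (x, 0) = f x & forall x, h (x, 1) = g x].

Definition homotopy_equivalence (X Y : topologicalType) (f : X -> Y) : Prop :=
  continuous f /\
  exists g : Y -> X,
    [/\ continuous g, homotopic (g \o f) id & homotopic (f \o g) id].
End Homotopy.

Section Sides.
Variables (R : realType) (gT : finGroupType) (G : graph).

Definition hom_space (H : graph) : topologicalType := realization R (hom G H).

Definition hom_balanced_space (T : right_graph gT) (H : left_graph gT) :
    topologicalType :=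
  balanced_space (realization_ract R (hom_rposet G T))
                 (realization_lact R (hom_lposet G H)).

Definition hom_balanced_pi (T : right_graph gT) (H : left_graph gT)
    (x : hom_space T) (y : hom_space H) : hom_balanced_space T H :=
  balanced_space_pi (realization_ract R (hom_rposet G T))
                    (realization_lact R (hom_lposet G H)) x y.
End Sides.
Arguments hom_balanced_pi {R gT G T H} x y.

Definition hom_space_map (R : realType) (G G' H H' : graph) (u : ghom G' G)
    (v : ghom H H') : hom_space R G H -> hom_space R G' H' :=
  realization_map (hom_map u v).

(* Main.v *)
From HB Require Import structures.
Require Import Defs.
From mathcomp Require Import all_boot all_order all_algebra all_fingroup.
From mathcomp Require Import all_classical all_reals topology normedtype.
From mathcomp Require Import generic_quotient zify lra.

(* A point of |A| x |B| is a pair of probability distributions supported on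
   chains; their monotone coupling is supported on a chain of A x B, and it is the
   only such coupling, so |A| x |B| maps naturally to |A x B|. The comparison map
   is induced by (f, h) |-> q (f x h), where q : T x H -> T x_Gamma H.
   If every vertex of G has a neighbour, q is a covering along which squares and
   closed walks through one non-tree edge lift, so Hom(G, T x_Gamma H) is the
   quotient of Hom(G, T x H) by Gamma: the inverse map lifts a point and projects
   it to both factors. One composite is the identity and the other one is induced
   by a poset map above the identity, hence homotopic to it.
   Otherwise G is a single vertex without loop, and both sides contract onto the
   vertices given by the largest multihomomorphisms. *)

Set Implicit Arguments.
Unset Strict Implicit.
Unset Printing Implicit Defensive.

Import Order.TTheory GRing.Theory Num.Theory.
Import numFieldNormedType.Exports.

(* The names [hom] and [Hom] are taken by the vector space library. *)
Local Notation hom := Defs.hom.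

(** * Lifting multihomomorphisms *)

(** Two points of one fibre of [q] differ by a group element [a], and a walk of fewer than [m] steps
    between their [H]-coordinates forces [a = 1]. So a closed walk in the quotient lifts to a closed
    walk once it has fewer than [m] edges. A square has 4 = 5 - 1 edges, and a tree path of length
    at most [d] closed by one further edge has at most d + 1 = (d + 2) - 1: this is the origin of
    the two bounds. The obstacle is a vertex of [G] without neighbour: its value may contain several
    points of one fibre, so passing to the image in the quotient loses information and lifts are no
    longer unique up to the group. One composite is only homotopic to the identity because a
    multihomomorphism into [T] x [H] may be strictly smaller than the product of its two
    projections. The other one is the identity because a product is recovered from its projections,
    so a homotopy on the balanced product itself is constructed only in the edgeless case. *)

Section Walks.
Variables (X : eqType) (e : rel X).

Lemma walk1 x y : e x y -> walk e x y 1.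
Proof. by move=> xy; exists [:: y]; split=> //=; rewrite xy. Qed.

Lemma walk_cat x y z k l : walk e x y k -> walk e y z l -> walk e x z (k + l).
Proof.
move=> [p [pp lp <-]] [p' [pp' lp' <-]]; exists (p ++ p').
by rewrite cat_path pp lp pp' last_cat lp lp' size_cat.
Qed.

Lemma walk_is_dist x y k : walk e x y k -> exists2 n, is_dist e x y n & (n <= k)%N.
Proof.
move=> wk; have ex : exists n, `[< walk e x y n >] by exists k; apply/asboolP.
case: (ex_minnP ex) => n /asboolP wn nmin; exists n; last exact/nmin/asboolP.
by split=> // l /asboolP /nmin.
Qed.

End Walks.

Lemma connect_walk (X : finType) (e : rel X) x y :
  connect e x y -> exists k, walk e x y k.
Proof. by move=> /connectP[p pp ->]; exists (size p), p. Qed.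

Lemma walk_map (X Y : eqType) (e : rel X) (e' : rel Y) (f : X -> Y) x y k :
  (forall u v, e u v -> e' (f u) (f v)) -> walk e x y k -> walk e' (f x) (f y) k.
Proof.
move=> fe [p [pp <- <-]]; exists (map f p).
by rewrite last_map size_map path_map; split=> //; exact: sub_path pp.
Qed.

(* A maximal connected set carrying a solution is everything: by acyclicity, a
   new vertex adjacent to it has only one neighbour in it. *)
Lemma acyclic_extension (X : finType) (Y : Type) (e : rel X) (r : X)
    (ok : X -> Y -> Prop) (c : Y -> Y -> Prop) :
  symmetric e -> irreflexive e -> (forall x, connect e r x) ->
  (forall s, ucycle e s -> (size s <= 2)%N) ->
  (exists y, ok r y) -> (forall y y', c y y' -> c y' y) ->
  (forall x x' y, e x x' -> ok x y -> exists2 y', ok x' y' & c y y') ->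
  exists f : X -> Y, (forall x, ok x (f x)) /\ (forall x x', e x x' -> c (f x) (f x')).
Proof.
move=> esym eirr econn eacyc [y0 oky0] csym ext.
pose eS (S : {set X}) := [rel u v | [&& u \in S, v \in S & e u v]].
pose good (S : {set X}) := `[< [/\ r \in S, (forall u, u \in S -> connect (eS S) r u) &
  exists f : X -> Y, (forall x, x \in S -> ok x (f x)) /\
    (forall x x', x \in S -> x' \in S -> e x x' -> c (f x) (f x'))] >].
have good1 : good [set r].
  apply/asboolP; split; first by rewrite inE.
    by move=> u; rewrite inE => /eqP->; exact: connect0.
  exists (fun=> y0); split=> [x|x x']; first by rewrite inE => /eqP->.
  by rewrite !inE => /eqP-> /eqP->; rewrite eirr.
case: (arg_maxnP (fun S : {set X} => #|S|) good1) => S /asboolP[rS Sconn [f [fok fc]]] Smax.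
have eS_sym : symmetric (eS S) by move=> u v; rewrite /= andbCA esym.
have [ST|/fintype.subsetPn[z _ zS]] := boolP ([set: X] \subset S).
  have inS x : x \in S by apply: (fintype.subsetP ST); rewrite inE.
  by exists f; split=> [x|x x' xx']; [exact: fok|exact: fc].
have [x [y [xS yS xy]]] : exists x y, [/\ x \in S, y \notin S & e x y].
  have /connectP[p pp pz] := econn z;
  elim: p (r) rS pp pz => /= [|v p IH] u uS.
    by move=> _ zu; rewrite zu uS in zS.
  move=> /andP[uv vp] zp; have [vS|vS] := boolP (v \in S); first exact: IH vS vp zp.
  by exists u, v.
have onlyx x' : x' \in S -> e x' y -> x' = x.
  move=> x'S x'y; have /connectP[p0 pp0 lp0] : connect (eS S) x x'.
    apply: (@connect_trans _ _ r); last exact: Sconn.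
    by rewrite (sym_connect_sym eS_sym); exact: Sconn.
  case/shortenP: pp0 lp0 => p pp up _ lp.
  have pS : all [in S] (x :: p).
    rewrite /= xS /=; elim: p (x) pp {up lp} => //= v p IH u /andP[/and3P[_ vS _] vp].
    by rewrite vS; exact: IH vp.
  have cyc : ucycle e (y :: x :: p).
    apply/andP; split.
      rewrite /= rcons_path esym xy /= -lp x'y andbT.
      by apply: sub_path pp => u v /and3P[].
    rewrite [uniq _]/= -[(x \notin p) && uniq p]/(uniq (x :: p)) up andbT.
    by apply: contra yS => /(allP pS).
  by have := eacyc _ cyc; case: p lp {pp up pS cyc} => //=.
have [y' oky' cy'] := ext _ _ _ xy (fok _ xS).
suff good' : good (y |: S)%SET.
  by have := Smax _ good'; rewrite cardsU1 yS /= ltnn.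
have sub u v : connect (eS S) u v -> connect (eS (y |: S)%SET) u v.
  apply: connect_sub => a b /and3P[aS bS ab]; apply: connect1.
  by rewrite /= !inE aS bS ab !orbT.
apply/asboolP; split; first by rewrite !inE rS orbT.
  move=> u; rewrite !inE => /orP[/eqP->|uS]; last exact/sub/Sconn.
  apply: connect_trans (sub _ _ (Sconn _ xS)) _; apply: connect1.
  by rewrite /= !inE xS eqxx orbT.
exists (fun u => if u == y then y' else f u); split.
  by move=> u; rewrite !inE; case: eqP => [->|_ /= /fok].
have ny u : u \in S -> (u == y) = false by apply: contraTF => /eqP->.
move=> u v; rewrite !inE => /orP[/eqP->|uS] /orP[/eqP->|vS].
- by rewrite eirr.
- rewrite eqxx ny // esym => vy; rewrite (onlyx _ vS vy); exact: csym.
- by rewrite eqxx ny // => uy; rewrite (onlyx _ uS uy).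
- by rewrite !ny //; exact: fc.
Qed.

(** * The quotient map of graphs and its lifting properties *)

Section Covering.
Variables (gT : finGroupType) (T : right_graph gT) (H : left_graph gT).

Local Notation X := (gprod T H).
Local Notation q := (@gbalanced_pi gT T H).

Definition fst_ghom : ghom X T := @GHom X T fst (fun x y xy => proj1 (andP xy)).
Definition snd_ghom : ghom X H := @GHom X H snd (fun x y xy => proj2 (andP xy)).

Lemma gbalanced_pi_adj (x y : X) : adj x y -> adj (q x) (q y).
Proof. by move=> xy; apply/gbalanced_adjP; exists x, y. Qed.

Definition pi_ghom : ghom X (gbalanced T H) := GHom gbalanced_pi_adj.

(** The inverse turns the right action on [T] into a left one; the orbits of the resulting action
    are the fibres of the quotient map ([gbalanced_pi_eq]). *)
Definition diag_act (a : gT) (x : X) : X :=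
  (rgraph_act T x.1 a^-1%g, lgraph_act H a x.2).

Lemma diag_act_adj a (x y : X) : adj x y -> adj (diag_act a x) (diag_act a y).
Proof.
move=> /andP[xy1 xy2]; apply/andP; split=> /=.
  exact: rgraph_adj.
exact: lgraph_adj.
Qed.

Definition diag_ghom a : ghom X X := GHom (@diag_act_adj a).

Lemma diag_act1 x : diag_act 1 x = x.
Proof. by case: x => t h; rewrite /diag_act /= invg1 ract1 lact1. Qed.

Lemma diag_actM a b x : diag_act (a * b) x = diag_act a (diag_act b x).
Proof. by rewrite /diag_act /= invMg ractM lactM. Qed.

Lemma gbalanced_pi_eq (x y : X) : q x = q y <-> exists a, y = diag_act a x.
Proof.
split=> [/gbalanced_piP/existsP[a /andP[/eqP e1 /eqP e2]]|[a ->]].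
  by exists a; case: x y e1 e2 => t h [t' h'] /= -> ->;
    rewrite /diag_act /= -ractM mulgV ract1.
apply/gbalanced_piP/existsP; exists a.
by rewrite /= -ractM mulVg ract1 !eqxx.
Qed.

Lemma gbalanced_pi_surj (c : gbalanced T H) : exists x, q x = c.
Proof. by eexists; exact: gbalanced_reprK. Qed.

Lemma pi_diag_act a x : q (diag_act a x) = q x.
Proof. by apply/esym/gbalanced_pi_eq; exists a. Qed.

(** Some edge lies over the given one, and a translate of it starts at [x]. *)
Lemma adj_lift (x : X) (c : gbalanced T H) :
  adj (q x) c -> exists2 y, q y = c & adj x y.
Proof.
move=> /gbalanced_adjP[u [v [/esym/gbalanced_pi_eq[a ua] <- uv]]].
exists (diag_act a^-1 v); first exact: pi_diag_act.
by have := diag_act_adj a^-1 uv; rewrite ua -diag_actM mulVg diag_act1.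
Qed.

Section Discontinuous.
Variable m : nat.
Hypothesis Hm : discontinuous m H.

Lemma discontinuous_walk v a k :
  walk (@adj H) v (lgraph_act H a v) k -> (k < m)%N -> a = 1%g.
Proof.
move=> /walk_is_dist[n dn nk] km; apply/eqP/negPn/negP => a1.
have [m0 disc] := Hm; apply: (disc v a n a1 _ dn); lia.
Qed.

Lemma pi_inj_walk (x y : X) k :
  q x = q y -> walk (@adj H) x.2 y.2 k -> (k < m)%N -> x = y.
Proof.
move=> /gbalanced_pi_eq[a ->] w km.
by rewrite (discontinuous_walk w km) diag_act1.
Qed.

(** The lifted edge from [x] ends at some [y'] in the fibre of [y]. A walk of [k + 1] steps joins
    the [H]-coordinates of [y'] and [y], too short for distinct points of a fibre. *)
Lemma pi_adj_walk (x y : X) k :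
  adj (q x) (q y) -> walk (@adj H) x.2 y.2 k -> (k.+1 < m)%N -> adj x y.
Proof.
move=> /adj_lift[y' qy' xy'] w km; rewrite -(pi_inj_walk qy' (k := 1 + k)) //.
apply: walk_cat w; apply: walk1; rewrite adj_sym; exact: (ghomP snd_ghom xy').
Qed.

End Discontinuous.
End Covering.

(** * The induced map of Hom posets: lifting, fibres and surjectivity *)

Section HomCovering.
Variables (gT : finGroupType) (T : right_graph gT) (H : left_graph gT).
Variables (G : graph).

Local Notation X := (gprod T H).
Local Notation q := (@gbalanced_pi gT T H).
Local Notation E := (hom G X).
Local Notation K := (hom G (gbalanced T H)).

Definition hom_pi : {omorphism E -> K} := hom_map (ghom_id G) (pi_ghom T H).
Definition hom_fst : {omorphism E -> hom G T} := hom_map (ghom_id G) (fst_ghom T H).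
Definition hom_snd : {omorphism E -> hom G H} := hom_map (ghom_id G) (snd_ghom T H).
Definition hom_diag a : {omorphism E -> E} := hom_map (ghom_id G) (diag_ghom T H a).

Lemma hom_piE (e : E) g : hom_pi e g = [set q x | x in e g]%SET.
Proof. by rewrite ffunE. Qed.

Lemma prod_is_multihom (f : hom G T) (h : hom G H) :
  is_multihom (H := X) [ffun g => finset.setX (f g) (h g)].
Proof.
apply/andP; split.
  apply/forallP => g; rewrite ffunE.
  have /finset.set0Pn[t ft] := hom_neq0 f g; have /finset.set0Pn[y hy] := hom_neq0 h g.
  by apply/finset.set0Pn; exists (t, y); rewrite inE /= ft hy.
apply/forallP => g; apply/forallP => g'; apply/implyP => gg'; rewrite !ffunE.
apply/forallP => x; apply/implyP; rewrite inE => /andP[fx hx].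
apply/forallP => y; apply/implyP; rewrite inE => /andP[fy hy].
by apply/andP; split; [exact: (hom_adj gg' fx fy)|exact: (hom_adj gg' hx hy)].
Qed.

Definition hom_prod f h : E := Defs.Hom (prod_is_multihom f h).

Lemma hom_prod_le f f' h h' :
  (f <= f')%O -> (h <= h')%O -> (hom_prod f h <= hom_prod f' h')%O.
Proof.
move=> /hom_leP ff /hom_leP hh; apply/hom_leP => g; rewrite !ffunE.
by apply/fintype.subsetP => x; rewrite !inE => /andP[/(fintype.subsetP (ff g))->
  /(fintype.subsetP (hh g))->].
Qed.

Lemma hom_ext (G' H' : graph) (f f' : hom G' H') : (forall g, f g = f' g) -> f = f'.
Proof. by move=> ff; apply/val_inj/ffunP. Qed.

Lemma hom_fst_prod f h : hom_fst (hom_prod f h) = f.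
Proof.
apply: hom_ext => g; rewrite !ffunE; apply/finset.setP => t.
apply/imsetP/idP => [[x + ->]|ft]; first by rewrite inE => /andP[].
have /finset.set0Pn[y hy] := hom_neq0 h g.
by exists (t, y); rewrite // inE ft.
Qed.

Lemma hom_snd_prod f h : hom_snd (hom_prod f h) = h.
Proof.
apply: hom_ext => g; rewrite !ffunE; apply/finset.setP => y.
apply/imsetP/idP => [[x + ->]|hy]; first by rewrite inE => /andP[].
have /finset.set0Pn[t ft] := hom_neq0 f g.
by exists (t, y); rewrite // inE ft.
Qed.

Lemma le_hom_prod (e : E) : (e <= hom_prod (hom_fst e) (hom_snd e))%O.
Proof.
apply/hom_leP => g; apply/fintype.subsetP => x ex; rewrite ffunE inE.
rewrite ![(hom_map _ _ _) _]ffunE.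
by apply/andP; split; apply: imset_f.
Qed.

Lemma hom_pi_prod_act (f : hom G T) (h : hom G H) a :
  hom_pi (hom_prod (hom_ract_fun f a) h) = hom_pi (hom_prod f (hom_lact_fun a h)).
Proof.
apply: hom_ext => g; rewrite !hom_piE !ffunE; apply/finset.setP => c.
apply/imsetP/imsetP => -[[t y] /finset.setXP[]] /=.
  move=> /imsetP[t' ft' ->] hy ->; exists (t', lgraph_act H a y).
    by rewrite inE /= ft'; apply: imset_f.
  by apply/gbalanced_pi_eq; exists a; rewrite /diag_act /= -ractM mulgV ract1.
move=> ft /imsetP[y' hy' ->] ->; exists (rgraph_act T t a, y').
  by rewrite inE /= hy' andbT; apply: imset_f.
apply/esym/gbalanced_pi_eq; exists a.
by rewrite /diag_act /= -ractM mulgV ract1.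
Qed.

Lemma hom_pi_diag a (e : E) : hom_pi (hom_diag a e) = hom_pi e.
Proof.
apply: hom_ext => g; rewrite !hom_piE ffunE -imset_comp.
by apply: eq_imset => x /=; rewrite pi_diag_act.
Qed.

Lemma hom_fst_diag a (e : E) : hom_fst (hom_diag a e) = hom_ract_fun (hom_fst e) a^-1%g.
Proof. by apply: hom_ext => g; rewrite !ffunE -!imset_comp; exact: eq_imset. Qed.

Lemma hom_snd_diag a (e : E) : hom_snd (hom_diag a e) = hom_lact_fun a (hom_snd e).
Proof. by apply: hom_ext => g; rewrite !ffunE -!imset_comp; exact: eq_imset. Qed.

Variable m : nat.
Hypothesis Hm : discontinuous m H.
Hypothesis m5 : (5 <= m)%N.
Hypothesis neighbour : forall g : G, exists g', adj g g'.

(** The lift keeps the points of each [e g] that lie over [k g]; shrinking values preserves all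
    adjacencies. *)
Lemma hom_pi_lift (e : E) (k : K) :
  (k <= hom_pi e)%O -> exists2 e', (e' <= e)%O & hom_pi e' = k.
Proof.
move=> /hom_leP ke.
have lift_mem g c : c \in k g -> exists2 x, x \in e g & c = q x.
  by move=> /(fintype.subsetP (ke g)); rewrite hom_piE => /imsetP.
pose f : {ffun G -> {set X}} := [ffun g => [set x in e g | q x \in k g]%SET].
have fP : is_multihom f.
  apply/andP; split.
    apply/forallP => g; have /finset.set0Pn[c kc] := hom_neq0 k g.
    have [x ex cx] := lift_mem _ _ kc.
    by apply/finset.set0Pn; exists x; rewrite ffunE inE ex -cx.
  apply/forallP => g; apply/forallP => g'; apply/implyP => gg'; rewrite !ffunE.
  apply/forallP => x; apply/implyP; rewrite inE => /andP[ex _].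
  apply/forallP => y; apply/implyP; rewrite inE => /andP[ey _].
  exact: hom_adj gg' ex ey.
exists (Defs.Hom fP).
  by apply/hom_leP => g; apply/fintype.subsetP => x; rewrite ffunE inE => /andP[].
apply: hom_ext => g; rewrite hom_piE; apply/finset.setP => c.
apply/imsetP/idP => [[x + ->]|kc]; first by rewrite ffunE inE => /andP[].
by have [x ex cx] := lift_mem _ _ kc; exists x; rewrite // ffunE inE ex -cx.
Qed.

(** Any point of [e] at a neighbour of [g] is adjacent to both [x] and [y], which gives a walk of
    length 2. *)
Lemma hom_mem_pi_inj (e : E) g x y : x \in e g -> y \in e g -> q x = q y -> x = y.
Proof.
move=> ex ey xy; have [g' gg'] := neighbour g.
have /finset.set0Pn[z ez] := hom_neq0 e g'.
apply: (pi_inj_walk Hm xy (k := 1 + 1)); last by lia.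
apply: (walk_cat (y := z.2)); apply: walk1.
  exact: (ghomP (snd_ghom T H) (hom_adj gg' ex ez)).
by rewrite adj_sym; exact: (ghomP (snd_ghom T H) (hom_adj gg' ey ez)).
Qed.

Lemma hom_pi_reflect_le (e e1 e2 : E) :
  (e1 <= e)%O -> (e2 <= e)%O -> (hom_pi e1 <= hom_pi e2)%O -> (e1 <= e2)%O.
Proof.
move=> /hom_leP l1 /hom_leP l2 /hom_leP l12; apply/hom_leP => g.
apply/fintype.subsetP => x e1x.
have : q x \in hom_pi e1 g by rewrite hom_piE; apply: imset_f.
move=> /(fintype.subsetP (l12 g)); rewrite hom_piE => /imsetP[y e2y xy].
by rewrite (hom_mem_pi_inj (fintype.subsetP (l1 g) _ e1x)
  (fintype.subsetP (l2 g) _ e2y) xy).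
Qed.

Hypothesis Gconn : forall g g' : G, connect (@adj G) g g'.

(** A group element makes the two lifts share one point at [r]. Lifts of an edge from a common point
    agree, so equality spreads through the connected graph [G]. *)
Lemma hom_pi_fibre (r : G) (e e' : E) :
  hom_pi e = hom_pi e' -> exists a, e' = hom_diag a e.
Proof.
move=> ee'; have /finset.set0Pn[x ex] := hom_neq0 e r.
have : q x \in hom_pi e' r by rewrite -ee' hom_piE; apply: imset_f.
rewrite hom_piE => /imsetP[x' e'x' /gbalanced_pi_eq[a xa]]; exists a.
set e1 := hom_diag a e.
have e1x' : x' \in e1 r by rewrite ffunE xa; apply: imset_f.
have {ee'} e1e' : hom_pi e1 = hom_pi e' by rewrite hom_pi_diag.
have sub (f f' : E) g g' y : hom_pi f = hom_pi f' -> adj g g' ->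
    y \in f g -> y \in f' g -> f g' \subset f' g'.
  move=> ff' gg' fy f'y; apply/fintype.subsetP => z fz.
  have : q z \in hom_pi f' g' by rewrite -ff' hom_piE; apply: imset_f.
  rewrite hom_piE => /imsetP[z' f'z' zz'].
  rewrite (pi_inj_walk Hm zz' (k := 1 + 1)) //; last by lia.
  apply: (walk_cat (y := y.2)); apply: walk1.
    by rewrite adj_sym; exact: (ghomP (snd_ghom T H) (hom_adj gg' fy fz)).
  exact: (ghomP (snd_ghom T H) (hom_adj gg' f'y f'z')).
have step g g' y : adj g g' -> y \in e1 g -> y \in e' g -> e1 g' = e' g'.
  move=> gg' y1 y'; apply/eqP; rewrite finset.eqEsubset.
  by rewrite (sub _ _ _ _ y e1e' gg') // (sub _ _ _ _ y (esym e1e') gg').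
(* At [r] only one point is known to be shared. This yields equality of the whole sets at a
   neighbour, so the propagation starts at [r'] and reaches [r] later. *)
have [r' rr'] := neighbour r.
have er' := step _ _ _ rr' e1x' e'x'.
have propagate g g' : e1 g = e' g -> adj g g' -> e1 g' = e' g'.
  move=> eg gg'; have /finset.set0Pn[y y1] := hom_neq0 e1 g.
  by apply: (step _ _ y gg') => //; rewrite -eg.
apply/esym/hom_ext => g; have /connectP[p pp ->] := Gconn r' g.
elim: p (r') er' pp => //= v p IH u eu /andP[uv vp].
by apply: IH vp; exact: propagate uv.
Qed.

(** First a single point of each [k g] is lifted along the spanning tree, giving [s]; then [s]
    serves as a frame that selects, for every point of [k g], a lift close to it. *)
Lemma hom_pi_surj (e : rel G) d :
  (d + 2 <= m)%N -> spanning_tree e -> is_diam e d ->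
  forall k : K, exists th : E, hom_pi th = k.
Proof.
move=> md [[esym eirr eadj] [/card_gt0P[r _] econn eacyc]] [_ ediam] k.
have [s [sk sadj]] : exists s : G -> X, (forall g, q (s g) \in k g) /\
    (forall g g', e g g' -> adj (s g) (s g')).
  apply: (@acyclic_extension _ _ e r (fun g x => q x \in k g) (fun x y => adj x y)) => //.
  - have /finset.set0Pn[c kc] := hom_neq0 k r.
    by have [x xc] := gbalanced_pi_surj c; exists x; rewrite xc.
  - by move=> x y; rewrite adj_sym.
  - move=> g g' x gg' kx; have /finset.set0Pn[c kc] := hom_neq0 k g'.
    have [y yc xy] := adj_lift (hom_adj (eadj _ _ gg') kx kc).
    by exists y; rewrite ?yc.
(* For an edge outside the tree, the tree path between its ends has length at most [d];
   [pi_adj_walk] then asks for [d + 1 < m]. *)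
have {}sadj g g' : adj g g' -> adj (s g) (s g').
  move=> gg'; have [l /walk_is_dist[n dn _]] := connect_walk (econn g g').
  have nd := ediam _ _ _ dn; case: dn => w _.
  apply: (pi_adj_walk Hm (hom_adj gg' (sk g) (sk g')) (k := n)); last by lia.
  apply: (walk_map (f := fun g => (s g).2) _ w) => u v uv.
  exact: (ghomP (snd_ghom T H) (sadj _ _ uv)).
have [nb nbP] := choice neighbour.
have wadj (x y : X) : adj x y -> walk (@adj H) x.2 y.2 1.
  by move=> xy; apply: walk1; exact: (ghomP (snd_ghom T H) xy).
(* One neighbour [nb g] is enough to select the lifts: [near] shows that they are adjacent to [s] at
   every other neighbour too. *)
pose f : {ffun G -> {set X}} := [ffun g => [set x | (q x \in k g) && adj x (s (nb g))]%SET].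
have near g g' x : x \in f g -> adj g g' -> adj x (s g').
  rewrite ffunE inE => /andP[kx xs] gg'.
  (* Three sides [x], [s (nb g)], [s g], [s g'] of a square are known and the fourth follows, by
     [5 <= m]. The square [x], [s g'], [s g], [y] is closed likewise for the adjacency of [f g] and
     [f g']. *)
  apply: (pi_adj_walk Hm (hom_adj gg' kx (sk g')) (k := 1 + (1 + 1))); last by lia.
  apply: walk_cat (wadj _ _ xs) _; apply: (walk_cat (y := (s g).2)); apply: wadj.
    by rewrite adj_sym; exact/sadj/nbP.
  exact: sadj.
have lift_mem g c : c \in k g -> exists2 x, x \in f g & c = q x.
  move=> kc; have gn := nbP g; rewrite adj_sym in gn.
  have [x xc sx] := adj_lift (hom_adj gn (sk (nb g)) kc).
  by exists x; rewrite ?ffunE ?inE ?xc ?kc // adj_sym.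
have fP : is_multihom f.
  apply/andP; split.
    apply/forallP => g; have /finset.set0Pn[c kc] := hom_neq0 k g.
    by have [x fx _] := lift_mem _ _ kc; apply/finset.set0Pn; exists x.
  apply/forallP => g; apply/forallP => g'; apply/implyP => gg'.
  apply/forallP => x; apply/implyP => fx; apply/forallP => y; apply/implyP => fy.
  have g'g : adj g' g by rewrite adj_sym.
  have kx : q x \in k g by move: fx; rewrite ffunE inE => /andP[].
  have ky : q y \in k g' by move: fy; rewrite ffunE inE => /andP[].
  apply: (pi_adj_walk Hm (hom_adj gg' kx ky) (k := 1 + (1 + 1))); last by lia.
  apply: walk_cat (wadj _ _ (near _ _ _ fx gg')) _.
  apply: (walk_cat (y := (s g).2)); apply: wadj; first exact: sadj.
  by rewrite adj_sym; exact: near fy g'g.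
exists (Defs.Hom fP); apply: hom_ext => g; rewrite hom_piE; apply/finset.setP => c.
apply/imsetP/idP => [[x + ->]|kc]; first by rewrite ffunE inE => /andP[].
by have [x ex cx] := lift_mem _ _ kc; exists x.
Qed.

End HomCovering.

(** * Topology of the order complex *)

Local Open Scope classical_set_scope.
Local Open Scope ring_scope.

Lemma hausdorff_coordinates (X Y : topologicalType) (I : Type) (f : I -> X -> Y) :
  hausdorff_space Y -> (forall i, continuous (f i)) ->
  (forall x y, f ^~ x =1 f ^~ y -> x = y) -> hausdorff_space X.
Proof.
move=> hY fc fi p q pq; apply: fi => i /=; apply: hY => A B Ap Bq.
have [z [Az Bz]] := pq _ _ (fc i _ _ Ap) (fc i _ _ Bq).
by exists (f i z).
Qed.

Lemma compact_set_type (X : topologicalType) (A : set X) :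
  compact A -> compact [set: set_type A].
Proof.
move=> cA F PF _; have FA : (set_val @ F) A.
  by apply: (@filterS _ F _ setT) filterT => x _; exact: set_valP.
have [p [Ap cp]] := cA _ _ FA.
exists (exist _ p (mem_set Ap)); split=> // U V FU [V' [[W oW <-] Wp] sV].
have FU' : (set_val @ F) (set_val @` U)
  by apply: (@filterS _ F _ U) FU => x Ux; exists x.
have [z [Uz Wz]] := cp _ _ FU' (open_nbhs_nbhs (conj oW Wp)).
by case: Uz => y Uy yz; exists y; split=> //; apply: sV; rewrite /= yz.
Qed.

Lemma continuous_sumr (R : realType) (X : topologicalType) (I : Type) (r : seq I)
    (P : pred I) (f : I -> X -> R) :
  (forall i, continuous (f i)) ->
  continuous (fun x => \sum_(i <- r | P i) f i x).
Proof.
move=> fc; elim: r => [|i r IH].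
  under eq_fun do rewrite big_nil; exact: cst_continuous.
under eq_fun do rewrite big_cons; case: (P i) => // x.
by apply: cvgD; [exact: fc|exact: IH].
Qed.

Section RealizationTopology.
Variables (R : realType) (d : Order.disp_t) (Q : finPOrderType d).

Lemma weight_continuous (q : Q) :
  continuous (fun x : realization R Q => val x q).
Proof.
move=> x; apply: (@continuous_comp _ _ _ _ (fun z : {ptws Q -> R} => z q)).
  exact: initial_continuous.
exact: (@proj_continuous Q (fun=> R : topologicalType) q).
Qed.

Lemma realization_continuous (X : topologicalType) (f : X -> realization R Q) :
  (forall q, continuous (fun x => val (f x) q)) -> continuous f.
Proof.
move=> fc; apply: continuous_comp_initial => x.
apply/cvg_sup => q; apply: (@continuous_comp_initial _ _ _ _ (fun x => val (f x))).
exact: fc.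
Qed.

Lemma realization_hausdorff : hausdorff_space (realization R Q).
Proof.
apply: (hausdorff_coordinates (@Rhausdorff R) weight_continuous) => x y xy.
by apply/val_inj/funext.
Qed.

Lemma realization_compact : compact [set: realization R Q].
Proof.
apply: compact_set_type.
have pc (q : Q) : continuous (fun z : {ptws Q -> R} => z q).
  exact: (@proj_continuous Q (fun=> R : topologicalType) q).
apply: (@subclosed_compact _ _
  [set f : {ptws Q -> R} | forall q, `[0, 1]%classic (f q)]); last 2 first.
- apply: (@tychonoff Q (fun=> R : topologicalType) (fun=> `[0, 1]%classic)) => q.
  exact: segment_compact.
- move=> x [x0 x1 _] q /=; rewrite in_itv /= x0 -x1 (bigD1 q) //= lerDl.
  exact: sumr_ge0.
(* Written with closed conditions only: the support is a chain when the product of any two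
   incomparable coordinates vanishes. *)
rewrite (_ : @realization_set R d Q =
  (\bigcap_q [set x : {ptws Q -> R} | 0 <= x q]) `&`
  ([set x : {ptws Q -> R} | \sum_q x q = 1] `&`
   \bigcap_(pq in [set pq : Q * Q | ~~ (pq.1 >=< pq.2)%O])
     [set x : {ptws Q -> R} | x pq.1 * x pq.2 = 0])); last first.
  apply/seteqP; split=> [x [x0 x1 xc]|x [x0 [x1 xc]]].
    split; first by move=> q _; exact: x0.
    split=> // -[p q] /= npq; apply/eqP; rewrite mulf_eq0.
    by apply: contraNT npq; rewrite negb_or => /andP[xp xq]; apply: xc.
  split=> // [q|p q xp xq]; first exact: x0.
  apply/negPn/negP => npq; have /eqP := xc (p, q) npq.
  by rewrite mulf_eq0 (negPf xp) (negPf xq).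
apply: closedI; first apply: closed_bigI => q _.
  by apply: (@preimage_closed _ _ (fun x : {ptws Q -> R} => x q)
    [set y | 0 <= y] _ (@closed_ge R 0)); move=> x _; exact: pc.
apply: closedI.
  apply: (@preimage_closed _ _ (fun x : {ptws Q -> R} => \sum_q x q)
    [set y | y = 1] _ (@closed_eq R 1)); move=> x _.
  exact: (@continuous_sumr R {ptws Q -> R} Q (index_enum Q) xpredT (fun q z => z q) pc x).
apply: closed_bigI => -[p q] _.
apply: (@preimage_closed _ _ (fun x : {ptws Q -> R} => x p * x q)
  [set y | y = 0] _ (@closed_eq R 0)); move=> x _.
exact: (@cvgM R _ _ _ _ _ _ _ (pc p x) (pc q x)).
Qed.

End RealizationTopology.

Lemma finite_chain_top d (Q : finPOrderType d) (S : pred Q) :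
  (exists q, S q) -> {in S &, forall p q, (p >=< q)%O} ->
  exists2 m, S m & forall q, S q -> (q <= m)%O.
Proof.
move=> [q0 Sq0] Sc; pose D q := #|[pred p : Q | (p <= q)%O]|.
case: (arg_maxnP D Sq0) => m Sm mmax; exists m => // q Sq.
case/orP: (Sc _ _ Sq Sm) => // mq.
have sub : [pred p : Q | (p <= m)%O] \subset [pred p | (p <= q)%O].
  by apply/fintype.subsetP => p; rewrite !inE => /le_trans; exact.
have := mmax _ Sq; rewrite /= (geq_leqif (subset_leqif_card sub)).
by move=> /fintype.subsetP/(_ q); rewrite !inE lexx => /(_ isT).
Qed.

(** * Monotone couplings of distributions supported on chains *)

Section Mass.
Variables (R : realType) (d : Order.disp_t) (Q : finPOrderType d).

(** When the support of [x] is a chain, [scumul x q] and [cumul x q] are the left and right ends of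
    the quantile interval of a support element [q]. *)
Definition cumul (x : Q -> R) (q : Q) : R := \sum_(p | (p <= q)%O) x p.
Definition scumul (x : Q -> R) (q : Q) : R := \sum_(p | (p < q)%O) x p.

Lemma cumulE x q : cumul x q = x q + scumul x q.
Proof.
rewrite /cumul (bigD1 q) //=; congr (_ + _).
by apply: eq_bigl => p; rewrite lt_neqAle andbC.
Qed.

Lemma scumul_ge0 x q : (forall p, 0 <= x p) -> 0 <= scumul x q.
Proof. by move=> x0; apply: sumr_ge0. Qed.

Lemma cumul_le_scumul x p q :
  (forall r, 0 <= x r) -> (p < q)%O -> cumul x p <= scumul x q.
Proof.
move=> x0 pq; rewrite /scumul (bigID (fun r => (r <= p)%O)) /=.
rewrite (eq_bigl (fun r => (r <= p)%O)) => [|r]; last first.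
  by rewrite andb_idl // => /le_lt_trans; exact.
by rewrite lerDl; apply: sumr_ge0.
Qed.

(** Along the support, [scumul] at an element is [cumul] at its predecessor, so the sum telescopes;
    elements of weight zero contribute nothing. The induction splits off the largest support element
    [m] of [D] and continues with the elements below [m]. *)
Lemma telescope_chain x (phi : R -> R) (D : pred Q) :
  (forall p q, x p != 0 -> x q != 0 -> (p >=< q)%O) ->
  (forall p q, (p <= q)%O -> D q -> D p) ->
  \sum_(q | D q) (phi (cumul x q) - phi (scumul x q)) =
  phi (\sum_(q | D q) x q) - phi 0.
Proof.
move=> xc; have [n] := ubnP #|D|; elim: n D => // n IH D Dn Ddown.
have term0 q : x q = 0 -> phi (cumul x q) - phi (scumul x q) = 0.
  by move=> xq; rewrite cumulE xq add0r subrr.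
have [[q Sq]|none] := pselect (exists q, D q && (x q != 0)); last first.
  have x0 q : D q -> x q = 0.
    by move=> Dq; apply/eqP/negPn/negP => xq; apply: none; exists q; rewrite Dq.
  by rewrite !big1 ?subrr // => q /x0 // /term0.
have [|m /andP[Dm xm] mmax] := @finite_chain_top _ _ (fun q => D q && (x q != 0))
  (ex_intro _ q Sq).
  by move=> p r /andP[_ ?] /andP[_ ?]; exact: xc.
have Dm_small : (#|[pred p | (p < m)%O]| < n)%N.
  apply: leq_trans (_ : (#|D| <= n)%N) => //.
  apply: proper_card; apply/properP; split.
    by apply/fintype.subsetP => p; rewrite !inE => /ltW/Ddown; apply.
  by exists m; rewrite // !inE ltxx.
have {IH Dm_small} := IH _ Dm_small.
have restrict (F : Q -> R) : (forall q, x q = 0 -> F q = 0) ->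
    \sum_(q | D q) F q = F m + \sum_(q | (q < m)%O) F q.
  move=> F0; rewrite (bigD1 m) //=; congr (_ + _).
  rewrite [LHS](bigID (fun q => (q < m)%O)) /= [X in _ + X]big1 ?addr0.
    apply: eq_bigl => p; rewrite andb_idl // => pm.
    by rewrite (Ddown _ _ (ltW pm)) //= (lt_eqF pm).
  move=> p /andP[/andP[Dp pm]]; rewrite lt_neqAle pm /= => npm.
  by apply: F0; apply/eqP; apply: contraNT npm => xp; apply: mmax; rewrite Dp.
rewrite !restrict //= => ->; last by move=> p r pr /(le_lt_trans pr).
by rewrite cumulE /scumul; lra.
Qed.

End Mass.

Section Coupling.
Variables (R : realType) (d d' : Order.disp_t).
Variables (A : finPOrderType d) (B : finPOrderType d').

Definition is_coupling (z : A * B -> R) (x : A -> R) (y : B -> R) : Prop :=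
  [/\ forall p, 0 <= z p,
      forall a, \sum_(p | p.1 == a) z p = x a,
      forall b, \sum_(p | p.2 == b) z p = y b
    & forall p q, z p != 0 -> z q != 0 ->
        ((p.1 <= q.1)%O && (p.2 <= q.2)%O) || ((q.1 <= p.1)%O && (q.2 <= p.2)%O)].

(* Monotone (quantile) coupling: the atom at [(a, b)] is the length of the
   intersection of the quantile intervals of [a] and [b]. *)
Definition coupling (x : A -> R) (y : B -> R) (p : A * B) : R :=
  Num.min (cumul x p.1) (cumul y p.2) - Num.min (scumul x p.1) (cumul y p.2)
  - Num.min (cumul x p.1) (scumul y p.2)
  + Num.min (scumul x p.1) (scumul y p.2).

(* On the support of [z], which is a chain, the down-sets [s x B] and [A x t] are
   nested. *)
Lemma coupling_mass z x y (s : pred A) (t : pred B) :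
  is_coupling z x y ->
  (forall a a', (a <= a')%O -> s a' -> s a) ->
  (forall b b', (b <= b')%O -> t b' -> t b) ->
  \sum_(p | s p.1 && t p.2) z p =
  Num.min (\sum_(a | s a) x a) (\sum_(b | t b) y b).
Proof.
move=> [z0 zx zy zc] sdown tdown.
have -> : \sum_(a | s a) x a = \sum_(p | s p.1) z p.
  rewrite [RHS](partition_big fst s) //=; apply: eq_bigr => a sa.
  rewrite -zx; apply: eq_bigl => p.
  by case: eqP => [->|]; rewrite ?sa ?andbF.
have -> : \sum_(b | t b) y b = \sum_(p | t p.2) z p.
  rewrite [RHS](partition_big snd t) //=; apply: eq_bigr => b tb.
  rewrite -zy; apply: eq_bigl => p.
  by case: eqP => [->|]; rewrite ?tb ?andbF.
have le1 : \sum_(p | s p.1 && t p.2) z p <= \sum_(p | s p.1) z p.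
  by rewrite [leRHS](bigID (fun p => t p.2)) /= lerDl; exact: sumr_ge0.
have le2 : \sum_(p | s p.1 && t p.2) z p <= \sum_(p | t p.2) z p.
  rewrite [leRHS](bigID (fun p => s p.1)) /=.
  under eq_bigl do rewrite andbC.
  by rewrite lerDl; exact: sumr_ge0.
have [[p /and3P[zp sp tp]]|none] :=
  pselect (exists p, [&& z p != 0, s p.1 & ~~ t p.2]).
  suff e : \sum_(p | s p.1 && t p.2) z p = \sum_(p | t p.2) z p.
    by rewrite -e in le2 *; rewrite min_r.
  rewrite [RHS](bigID (fun p => s p.1)) /= [X in _ + X]big1 ?addr0.
    by apply: eq_bigl => q; rewrite andbC.
  move=> q /andP[tq sq]; apply/eqP/negPn/negP => zq.
  case/orP: (zc _ _ zp zq) => /andP[le1' le2'].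
    by rewrite (tdown _ _ le2') in tp.
  by rewrite (sdown _ _ le1') in sq.
suff e : \sum_(p | s p.1 && t p.2) z p = \sum_(p | s p.1) z p.
  by rewrite -e in le1 *; rewrite min_l.
rewrite [RHS](bigID (fun p => t p.2)) /= [X in _ + X]big1 ?addr0 //.
move=> q /andP[sq tq]; apply/eqP/negPn/negP => zq.
by apply: none; exists q; rewrite zq sq.
Qed.

(** By [coupling_mass] the marginals fix the mass of every product of down-sets. Inclusion-exclusion
    over the four products of closed or open down-sets of [a] and [b] isolates the value at
    [(a, b)]. *)
Lemma coupling_unique z x y : is_coupling z x y -> z =1 coupling x y.
Proof.
move=> zP [a b]; rewrite /coupling /cumul /scumul /=.
have le_down d0 (Q : finPOrderType d0) (q : Q) :
    forall p p', (p <= p')%O -> (p' <= q)%O -> (p <= q)%O.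
  by move=> p p' /le_trans h /h.
have lt_down d0 (Q : finPOrderType d0) (q : Q) :
    forall p p', (p <= p')%O -> (p' < q)%O -> (p < q)%O.
  by move=> p p' /le_lt_trans h /h.
have mass := coupling_mass zP.
rewrite -(mass (fun a' => a' <= a)%O (fun b' => b' <= b)%O); do ?exact: le_down.
rewrite -(mass (fun a' => a' < a)%O (fun b' => b' <= b)%O);
  do ?[exact: le_down|exact: lt_down].
rewrite -(mass (fun a' => a' <= a)%O (fun b' => b' < b)%O);
  do ?[exact: le_down|exact: lt_down].
rewrite -(mass (fun a' => a' < a)%O (fun b' => b' < b)%O); do ?exact: lt_down.
have splitA (t : pred B) : \sum_(p | (p.1 <= a)%O && t p.2) z p =
    \sum_(p | (p.1 == a) && t p.2) z p + \sum_(p | (p.1 < a)%O && t p.2) z p.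
  rewrite (bigID (fun p => p.1 == a)) /=; congr (_ + _); apply: eq_bigl => p.
    by case: eqP => [->|]; rewrite ?lexx ?andbT ?andbF.
  by rewrite lt_neqAle andbAC [X in X && _]andbC.
rewrite (splitA (fun b' => b' <= b)%O) (splitA (fun b' => b' < b)%O).
have -> : \sum_(p | (p.1 == a) && (p.2 <= b)%O) z p =
    z (a, b) + \sum_(p | (p.1 == a) && (p.2 < b)%O) z p.
  rewrite (bigD1 (a, b)) /= ?eqxx ?lexx //; congr (_ + _); apply: eq_bigl => p.
  case: p => a' b' /=; rewrite xpair_eqE; case: eqP => //= _.
  by rewrite lt_neqAle andbC.
by lra.
Qed.

Section Existence.
Variables (x : A -> R) (y : B -> R).
Hypotheses (x0 : forall a, 0 <= x a) (y0 : forall b, 0 <= y b).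

Lemma coupling_ge0 p : 0 <= coupling x y p.
Proof.
case: p => a b; rewrite /coupling /= !cumulE.
have := scumul_ge0 a x0; have := scumul_ge0 b y0; have := x0 a; have := y0 b.
move=> *; have [?|?] := lerP (x a + scumul x a) (y b + scumul y b);
  have [?|?] := lerP (scumul x a) (y b + scumul y b);
  have [?|?] := lerP (x a + scumul x a) (scumul y b);
  have [?|?] := lerP (scumul x a) (scumul y b); lra.
Qed.

(** A nonzero value means that the two quantile intervals overlap in positive length. *)
Lemma coupling_gt0 p : coupling x y p != 0 ->
  [/\ x p.1 != 0, y p.2 != 0, scumul x p.1 < cumul y p.2
    & scumul y p.2 < cumul x p.1].
Proof.
case: p => a b /= c0; split.
- by apply: contraNneq c0 => xa; rewrite /coupling /= !cumulE xa add0r; apply/eqP; lra.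
- by apply: contraNneq c0 => yb; rewrite /coupling /= !cumulE yb add0r; apply/eqP; lra.
- rewrite ltNge; apply: contraNN c0; rewrite /coupling /= !cumulE => h.
  have := x0 a; have := y0 b.
  move=> *; apply/eqP; have [?|?] := lerP (x a + scumul x a) (y b + scumul y b);
    have [?|?] := lerP (scumul x a) (y b + scumul y b);
    have [?|?] := lerP (x a + scumul x a) (scumul y b);
    have [?|?] := lerP (scumul x a) (scumul y b); lra.
- rewrite ltNge; apply: contraNN c0; rewrite /coupling /= !cumulE => h.
  have := x0 a; have := y0 b.
  move=> *; apply/eqP; have [?|?] := lerP (x a + scumul x a) (y b + scumul y b);
    have [?|?] := lerP (scumul x a) (y b + scumul y b);
    have [?|?] := lerP (x a + scumul x a) (scumul y b);
    have [?|?] := lerP (scumul x a) (scumul y b); lra.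
Qed.

End Existence.

Lemma coupling_marginal1 (x : A -> R) (y : B -> R) a :
  (forall a, 0 <= x a) -> \sum_a x a = 1 ->
  (forall b, 0 <= y b) -> \sum_b y b = 1 ->
  (forall p q, y p != 0 -> y q != 0 -> (p >=< q)%O) ->
  \sum_(p | p.1 == a) coupling x y p = x a.
Proof.
move=> x0 x1 y0 y1 yc.
have -> : \sum_(p | p.1 == a) coupling x y p = \sum_b coupling x y (a, b).
  rewrite (reindex (fun b => (a, b))) /=; first by apply: eq_bigl => b; rewrite eqxx.
  by exists snd => // -[a' b] /eqP /= ->.
(* [phi t] is the length of the part of the quantile interval of [a] below [t]; the sum over [b]
   telescopes to [phi 1 - phi 0]. *)
pose phi t := Num.min (cumul x a) t - Num.min (scumul x a) t.
rewrite (eq_bigr (fun b => phi (cumul y b) - phi (scumul y b))); last first.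
  by move=> b _; rewrite /phi /coupling /=; lra.
rewrite (telescope_chain phi yc) // y1 /phi.
have := scumul_ge0 a x0; have := x0 a.
have : cumul x a <= 1.
  by rewrite -x1 [leRHS](bigID (fun p => (p <= a)%O)) /= lerDl; exact: sumr_ge0.
rewrite cumulE => *.
have [?|?] := lerP (x a + scumul x a) 1; have [?|?] := lerP (scumul x a) 1;
  have [?|?] := lerP (x a + scumul x a) 0; have [?|?] := lerP (scumul x a) 0; lra.
Qed.

End Coupling.

Lemma coupling_sym (R : realType) d d' (A : finPOrderType d) (B : finPOrderType d')
    (x : A -> R) (y : B -> R) a b : coupling x y (a, b) = coupling y x (b, a).
Proof.
rewrite /coupling /= !(minC (cumul x a)) !(minC (scumul x a)).
by congr (_ + _); rewrite addrAC.
Qed.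

Section RealizationPoints.
Variables (R : realType) (d : Order.disp_t) (A : finPOrderType d).

Lemma realization_ge0 (x : realization R A) a : 0 <= val x a.
Proof. by have [] := set_valP x. Qed.

Lemma realization_sum1 (x : realization R A) : \sum_a val x a = 1.
Proof. by have [] := set_valP x. Qed.

Lemma realization_chain (x : realization R A) p q :
  val x p != 0 -> val x q != 0 -> (p >=< q)%O.
Proof. by have [_ _] := set_valP x; exact. Qed.

End RealizationPoints.

Lemma coupling_is_coupling (R : realType) d d' (A : finPOrderType d)
    (B : finPOrderType d') (x : realization R A) (y : realization R B) :
  is_coupling (coupling (val x) (val y)) (val x) (val y).
Proof.
have x0 := realization_ge0 x; have y0 := realization_ge0 y.
have x1 := realization_sum1 x; have y1 := realization_sum1 y.
have xc := realization_chain (x := x); have yc := realization_chain (x := y).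
split=> [p|a|b|[a b] [a' b'] ab ab'].
- exact: coupling_ge0.
- exact: coupling_marginal1.
- rewrite -(coupling_marginal1 b y0 y1 x0 x1 xc).
  rewrite (reindex (fun p : B * A => (p.2, p.1))) /=; last first.
    by exists (fun p : A * B => (p.2, p.1)) => -[].
  by apply: eq_bigr => -[b' a'] _; exact: coupling_sym.
(* Opposite orders would give the cycle [scumul w q < cumul z p <= scumul z p' < cumul w q' <=
   scumul w q]. *)
have cross d1 d2 (Q : finPOrderType d1) (Q' : finPOrderType d2)
    (z : realization R Q) (w : realization R Q') p p' q q' :
    coupling (val z) (val w) (p, q) != 0 -> coupling (val z) (val w) (p', q') != 0 ->
    (p < p')%O -> (q' < q)%O -> False.
  have z0 := realization_ge0 z; have w0 := realization_ge0 w.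
  move=> /(coupling_gt0 z0 w0)[_ _ _ /= h1] /(coupling_gt0 z0 w0)[_ _ /= h2 _] pp qq.
  have := cumul_le_scumul z0 pp; have := cumul_le_scumul w0 qq; lra.
have [xa yb _ _] := coupling_gt0 x0 y0 ab.
have [xa' yb' _ _] := coupling_gt0 x0 y0 ab'.
rewrite /= in xa yb xa' yb' *.
case: (comparable_ltgtP (xc _ _ xa xa')) => aa';
  case: (comparable_ltgtP (yc _ _ yb yb')) => bb' //=; rewrite ?orbT //.
  by case: (cross _ _ _ _ _ _ _ _ _ _ ab ab' aa' bb').
by case: (cross _ _ _ _ _ _ _ _ _ _ ab' ab aa' bb').
Qed.

Definition mk_omorphism d d' (Q : finPOrderType d) (Q' : finPOrderType d')
    (f : Q -> Q') (fP : forall p q, (p <= q)%O -> (f p <= f q)%O) :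
    {omorphism Q -> Q'} :=
  HB.pack f (Order.isOrderMorphism.Build _ _ _ _ f fP).

Section Join.
Variables (R : realType) (d d' d'' : Order.disp_t).
Variables (A : finPOrderType d) (B : finPOrderType d') (C : finPOrderType d'').
Variable mu : A -> B -> C.
Hypothesis muP : forall a a' b b',
  (a <= a')%O -> (b <= b')%O -> (mu a b <= mu a' b')%O.

Definition join_fun (x : realization R A) (y : realization R B) : {ptws C -> R} :=
  fun c => \sum_(p | mu p.1 p.2 == c) coupling (val x) (val y) p.

Lemma join_subproof x y : join_fun x y \in @realization_set R _ C.
Proof.
have [c0 c1 _ cc] := coupling_is_coupling x y; apply/mem_set; split.
- by move=> c; apply: sumr_ge0 => p _; exact: c0.
- transitivity (\sum_p coupling (val x) (val y) p).
    by rewrite [RHS](partition_big (fun p => mu p.1 p.2) xpredT).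
  rewrite (partition_big (fun p => p.1) xpredT) //= -(realization_sum1 x).
  by apply: eq_bigr => a _; exact: c1.
- have supp c : join_fun x y c != 0 ->
      exists2 p, mu p.1 p.2 = c & coupling (val x) (val y) p != 0.
    move=> /eqP /psumr_neq0P[p _|p /andP[/eqP pc p0]]; first exact: c0.
    by exists p => //; rewrite gt_eqF.
  move=> _ _ /supp[p <- p0] /supp[q <- q0].
  by case/orP: (cc _ _ p0 q0) => /andP[? ?]; apply/orP; [left|right]; exact: muP.
Qed.

(* The map induced by [mu] on [|A| x |B| ~ |A x B|]. *)
Definition join (x : realization R A) (y : realization R B) : realization R C :=
  exist _ (join_fun x y) (join_subproof x y).

(** By uniqueness any monotone coupling computes the join, so [join_diag] and [join_natural] avoid
    the formula with minima. *)
Lemma join_pushforward (I : finType) (z : I -> R) (u : I -> A * B) x y :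
  is_coupling (fun p => \sum_(i | u i == p) z i) (val x) (val y) ->
  forall c, val (join x y) c = \sum_(i | mu (u i).1 (u i).2 == c) z i.
Proof.
move=> /coupling_unique zE c.
transitivity (\sum_(p | mu p.1 p.2 == c) coupling (val x) (val y) p) => //.
under eq_bigr do rewrite -zE.
rewrite [RHS](partition_big u (fun p => mu p.1 p.2 == c)) //=.
apply: eq_bigr => p pc; apply: eq_bigl => i.
by rewrite andb_idl // => /eqP->.
Qed.

Lemma join_continuous :
  continuous (fun p : realization R A * realization R B => join p.1 p.2).
Proof.
apply: realization_continuous => c /=; apply: continuous_sumr => -[a b].
have fA (P : pred A) : continuous (fun p : realization R A * realization R B =>
    \sum_(a | P a) val p.1 a).
  apply: continuous_sumr => a' z.
  apply: (@continuous_comp _ _ _ fst (fun x : realization R A => val x a')).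
    exact: cvg_fst.
  exact: weight_continuous.
have fB (P : pred B) : continuous (fun p : realization R A * realization R B =>
    \sum_(b | P b) val p.2 b).
  apply: continuous_sumr => b' z.
  apply: (@continuous_comp _ _ _ snd (fun x : realization R B => val x b')).
    exact: cvg_snd.
  exact: weight_continuous.
move=> z; apply: cvgD; [apply: cvgB; [apply: cvgB|]|];
  by apply: continuous_min; [exact: fA|exact: fB].
Qed.

Lemma join_marginal1 (f : {omorphism C -> A}) x y :
  (forall a b, f (mu a b) = a) -> realization_map f (join x y) = x.
Proof.
move=> fmu; have [_ c1 _ _] := coupling_is_coupling x y.
apply/val_inj/funext => a; rewrite realization_mapE -c1 /=.
rewrite [RHS](partition_big (fun p => mu p.1 p.2) (fun c => f c == a)) /=; last first.
  by move=> p; rewrite fmu.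
apply: eq_bigr => c /eqP fc; apply: eq_bigl => p.
by rewrite andb_idl // => /eqP pc; rewrite -fc -pc fmu.
Qed.

Lemma join_marginal2 (f : {omorphism C -> B}) x y :
  (forall a b, f (mu a b) = b) -> realization_map f (join x y) = y.
Proof.
move=> fmu; have [_ _ c2 _] := coupling_is_coupling x y.
apply/val_inj/funext => b; rewrite realization_mapE -c2 /=.
rewrite [RHS](partition_big (fun p => mu p.1 p.2) (fun c => f c == b)) /=; last first.
  by move=> p; rewrite fmu.
apply: eq_bigr => c /eqP fc; apply: eq_bigl => p.
by rewrite andb_idl // => /eqP pc; rewrite -fc -pc fmu.
Qed.

(** The pair [(f, g)] is monotone, so it sends the chain carrying [e] to a chain, and the image of
    [e] is a monotone coupling of its own projections. *)
Lemma join_diag d0 (E : finPOrderType d0) (f : {omorphism E -> A})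
    (g : {omorphism E -> B}) (h : {omorphism E -> C}) (e : realization R E) :
  (forall i, h i = mu (f i) (g i)) ->
  join (realization_map f e) (realization_map g e) = realization_map h e.
Proof.
move=> hE; apply/val_inj/funext => c.
rewrite (@join_pushforward E (val e) (fun i => (f i, g i))); last first.
  split=> [p|a|b|p q].
  - by apply: sumr_ge0 => i _; exact: realization_ge0.
  - rewrite realization_mapE [RHS](partition_big (fun i => (f i, g i))
      (fun p => p.1 == a)) //=; apply: eq_bigr => p /eqP pa; apply: eq_bigl => i.
    by rewrite andb_idl // => /eqP ip; rewrite -pa -ip.
  - rewrite realization_mapE [RHS](partition_big (fun i => (f i, g i))
      (fun p => p.2 == b)) //=; apply: eq_bigr => p /eqP pa; apply: eq_bigl => i.
    by rewrite andb_idl // => /eqP ip; rewrite -pa -ip.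
  - have supp p0 : \sum_(i | (f i, g i) == p0) val e i != 0 ->
        exists2 i, (f i, g i) = p0 & val e i != 0.
      move=> /eqP /psumr_neq0P[i _|i /andP[/eqP ip i0]]; first exact: realization_ge0.
      by exists i => //; rewrite gt_eqF.
    move=> /supp[i <- i0] /supp[j <- j0] /=.
    by case/orP: (realization_chain i0 j0) => ij; apply/orP; [left|right];
      apply/andP; split; exact: omorph_le.
by rewrite realization_mapE; apply: eq_bigl => i; rewrite hE.
Qed.

End Join.

(** Order-preserving maps push a monotone coupling forward to a monotone coupling of the images of
    its marginals. *)
Lemma join_natural (R : realType) d1 d2 d3 d1' d2' d3'
    (A : finPOrderType d1) (B : finPOrderType d2) (C : finPOrderType d3)
    (A' : finPOrderType d1') (B' : finPOrderType d2') (C' : finPOrderType d3')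
    (mu : A -> B -> C) muP (mu' : A' -> B' -> C') muP'
    (f : {omorphism A -> A'}) (g : {omorphism B -> B'}) (h : {omorphism C -> C'})
    (x : realization R A) (y : realization R B) :
  (forall a b, h (mu a b) = mu' (f a) (g b)) ->
  realization_map h (@join R _ _ _ _ _ _ mu muP x y) =
  @join R _ _ _ _ _ _ mu' muP' (realization_map f x) (realization_map g y).
Proof.
move=> hmu; have [c0 c1 c2 cc] := coupling_is_coupling x y.
apply/val_inj/funext => c; rewrite realization_mapE.
rewrite (@join_pushforward _ _ _ _ _ _ _ _ _ _ (coupling (val x) (val y))
  (fun p => (f p.1, g p.2))); last first.
  split=> [p|a|b|p q].
  - by apply: sumr_ge0 => i _; exact: c0.
  - rewrite realization_mapE.
    transitivity (\sum_(p | f p.1 == a) coupling (val x) (val y) p); last first.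
      rewrite (partition_big (fun p => p.1) (fun a' => f a' == a)) //=.
      apply: eq_bigr => a' /eqP fa; rewrite -c1; apply: eq_bigl => p.
      by rewrite andb_idl // => /eqP->; rewrite fa.
    rewrite [RHS](partition_big (fun i => (f i.1, g i.2))
      (fun p => p.1 == a)) //=; apply: eq_bigr => p /eqP pa; apply: eq_bigl => i.
    by rewrite andb_idl // => /eqP ip; rewrite -pa -ip.
  - rewrite realization_mapE.
    transitivity (\sum_(p | g p.2 == b) coupling (val x) (val y) p); last first.
      rewrite (partition_big (fun p => p.2) (fun b' => g b' == b)) //=.
      apply: eq_bigr => b' /eqP gb; rewrite -c2; apply: eq_bigl => p.
      by rewrite andb_idl // => /eqP->; rewrite gb.
    rewrite [RHS](partition_big (fun i => (f i.1, g i.2))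
      (fun p => p.2 == b)) //=; apply: eq_bigr => p /eqP pa; apply: eq_bigl => i.
    by rewrite andb_idl // => /eqP ip; rewrite -pa -ip.
  - have supp p0 : \sum_(i | (f i.1, g i.2) == p0) coupling (val x) (val y) i != 0 ->
        exists2 i, (f i.1, g i.2) = p0 & coupling (val x) (val y) i != 0.
      move=> /eqP /psumr_neq0P[i _|i /andP[/eqP ip i0]]; first exact: c0.
      by exists i => //; rewrite gt_eqF.
    move=> /supp[i <- i0] /supp[j <- j0] /=.
    by case/orP: (cc _ _ i0 j0) => /andP[? ?]; apply/orP; [left|right];
      apply/andP; split; exact: omorph_le.
rewrite [RHS](partition_big (fun p => mu p.1 p.2) (fun c' => h c' == c)) /=; last first.
  by move=> p; rewrite hmu.
apply: eq_bigr => c' /eqP hc; apply: eq_bigl => p.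
by rewrite andb_idl // => /eqP pc; rewrite -hmu pc hc.
Qed.

Lemma realization_map_continuous (R : realType) d d' (Q : finPOrderType d)
    (Q' : finPOrderType d') (f : {omorphism Q -> Q'}) :
  continuous (realization_map (R := R) f).
Proof.
apply: realization_continuous => q; apply: continuous_sumr => p.
exact: weight_continuous.
Qed.

Lemma realization_top (R : realType) d (Q : finPOrderType d) (x : realization R Q) :
  exists2 m, val x m != 0 & forall q, val x q != 0 -> (q <= m)%O.
Proof.
apply: finite_chain_top => [|p q]; last exact: realization_chain.
apply: contrapT => none.
suff /eqP : \sum_q val x q = 0 by rewrite realization_sum1 oner_eq0.
by apply: big1 => q _; apply/eqP/negPn/negP => xq; apply: none; exists q.
Qed.

(** A continuous map from a compact space to a Hausdorff one is closed, and [h @^-1]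
    C[is the image of the closed set]g @^-1[C]. *)
Lemma continuous_descent (X Y Z : topologicalType) (p : X -> Y) (g : X -> Z)
    (h : Y -> Z) :
  compact [set: X] -> hausdorff_space Y -> continuous p -> continuous g ->
  (forall y, exists x, p x = y) -> (forall x, h (p x) = g x) -> continuous h.
Proof.
move=> cX hY pc gc psurj hp; apply/continuous_closedP => C clC.
rewrite (_ : h @^-1` C = p @` (g @^-1` C)); last first.
  apply/seteqP; split=> [y Cy|_ [x Cx <-]]; last by rewrite /= hp.
  by have [x xy] := psurj y; exists x; rewrite // /= -hp xy.
apply: compact_closed => //; apply: continuous_compact.
  exact: continuous_subspaceT.
apply: subclosed_compact cX _ => //.
by move/continuous_closedP: gc; apply.
Qed.

(** * Homotopies between comparable poset maps *)

Section UnitInterval.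
Variable R : realType.

(** Extends the homotopies to all real times, so that their continuity can be proved on the whole
    product instead of a subspace. *)
Definition clamp (t : R) : R := Num.min 1 (Num.max 0 t).

Lemma clamp_ge0 t : 0 <= clamp t.
Proof. by rewrite le_min ler01 le_max lexx. Qed.

Lemma clamp_le1 t : clamp t <= 1.
Proof. by rewrite ge_min lexx. Qed.

Lemma clamp0 : clamp 0 = 0.
Proof. by rewrite /clamp maxxx min_r. Qed.

Lemma clamp1 : clamp 1 = 1.
Proof. by rewrite /clamp max_r ?minxx. Qed.

Lemma clamp_continuous : continuous clamp.
Proof.
move=> t; apply: continuous_min; first exact: cvg_cst.
by apply: continuous_max; [exact: cvg_cst|exact: cvg_id].
Qed.

Definition interval_point_fun (t : R) : {ptws bool -> R} :=
  fun b => if b then 1 - clamp t else clamp t.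

Lemma interval_point_subproof t : interval_point_fun t \in @realization_set R _ bool.
Proof.
have := clamp_ge0 t; have := clamp_le1 t => t1 t0.
apply/mem_set; split.
- by move=> [] /=; lra.
- by rewrite big_bool /=; lra.
- by move=> [] [].
Qed.

(* Orientation: time [0] is the vertex [true]. *)
Definition interval_point (t : R) : realization R bool :=
  exist _ (interval_point_fun t) (interval_point_subproof t).

Lemma interval_point_continuous : continuous interval_point.
Proof.
apply: realization_continuous => -[] t /=.
  by apply: cvgB; [exact: cvg_cst|exact: clamp_continuous].
exact: clamp_continuous.
Qed.

Definition const_omorphism d d' (Q : finPOrderType d) (Q' : finPOrderType d')
    (m : Q') : {omorphism Q -> Q'} :=
  mk_omorphism (f := fun _ : Q => m) (fun _ _ _ => lexx m).

Definition id_omorphism d (Q : finPOrderType d) : {omorphism Q -> Q} :=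
  mk_omorphism (f := fun q : Q => q) (fun _ _ h => h).

(** Presents an end of the interval as an image of [x], so that both arguments of the join come from
    one point and [join_diag] applies. *)
Lemma interval_point_vertex (b : bool) d (Q : finPOrderType d) (x : realization R Q) :
  interval_point (~~ b)%:R = realization_map (const_omorphism Q b) x.
Proof.
apply/val_inj/funext => c; rewrite realization_mapE /=.
have sumE : \sum_(q | b == c) val x q = (b == c)%:R.
  case: eqP => _; first exact: realization_sum1.
  by rewrite big_pred0.
rewrite sumE /interval_point_fun.
by case: b {sumE}; case: c; rewrite /= ?clamp0 ?clamp1; lra.
Qed.

(** The inequality makes [mu] monotone on [Q] x [bool]; the homotopy is its join with a point moving
    along the realization of [bool]. Time 0 gives the larger map [g]. *)
Lemma poset_homotopy d d' (Q : finPOrderType d) (Q' : finPOrderType d')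
    (f g : {omorphism Q -> Q'}) :
  (forall q, (f q <= g q)%O) ->
  homotopic R (realization_map (R := R) g) (realization_map f).
Proof.
move=> fg; pose mu q (b : bool) := if b then g q else f q.
have muP q q' b b' : (q <= q')%O -> (b <= b')%O -> (mu q b <= mu q' b')%O.
  move=> qq'; case: b; case: b' => //= _; try exact: omorph_le.
  by apply: le_trans (fg q'); exact: omorph_le.
exists (fun z => join muP z.1 (interval_point z.2)); split.
- apply: continuous_subspaceT => z.
  apply: (@continuous_comp _ _ _ (fun z : realization R Q * R =>
    (z.1, interval_point z.2)) (fun p => join muP p.1 p.2)).
    have ic : {for z, continuous (fun z : realization R Q * R => interval_point z.2)}.
      apply: (@continuous_comp _ _ _ snd interval_point); first exact: cvg_snd.
      exact: interval_point_continuous.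
    exact: (cvg_pair cvg_fst ic).
  exact: join_continuous.
- move=> x /=; rewrite (interval_point_vertex true x).
  rewrite -{1}[x](realization_map_id (f := id_omorphism Q)) //.
  exact: join_diag.
- move=> x /=; rewrite (interval_point_vertex false x).
  rewrite -{1}[x](realization_map_id (f := id_omorphism Q)) //.
  exact: join_diag.
Qed.

End UnitInterval.

(** * Realizations of poset maps that are bijective on down-sets *)

Section Fibration.
Variables (R : realType) (d d' : Order.disp_t).
Variables (E : finPOrderType d) (K : finPOrderType d') (q : {omorphism E -> K}).
Hypothesis q_surj : forall k, exists e, q e = k.
Hypothesis q_lift : forall e k, (k <= q e)%O -> exists2 e', (e' <= e)%O & q e' = k.
Hypothesis q_refl : forall e e1 e2,
  (e1 <= e)%O -> (e2 <= e)%O -> (q e1 <= q e2)%O -> (e1 <= e2)%O.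

Lemma fibration_inj e e1 e2 : (e1 <= e)%O -> (e2 <= e)%O -> q e1 = q e2 -> e1 = e2.
Proof.
move=> h1 h2 h; apply/eqP; rewrite eq_le.
by apply/andP; split; [apply: q_refl h1 h2 _|apply: q_refl h2 h1 _]; rewrite h.
Qed.

(** Only the top of the support is lifted by choice, to [th]; the rest of the chain has unique lifts
    below [th], and these carry the weights of [z]. *)
Lemma realization_map_surj (z : realization R K) :
  exists x : realization R E, realization_map q x = z.
Proof.
have [m zm mtop] := realization_top z; have [th thm] := q_surj m.
pose x : {ptws E -> R} := fun e => if (e <= th)%O then val z (q e) else 0.
have push k : \sum_(e | q e == k) x e = val z k.
  have [zk|zk] := eqVneq (val z k) 0.
    by rewrite zk; apply: big1 => e /eqP qe; rewrite /x qe zk if_same.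
  have [e eth qe] : exists2 e, (e <= th)%O & q e = k by apply: q_lift; rewrite thm mtop.
  rewrite (bigD1 e) /= ?qe // big1 ?addr0 => [|e' /andP[/eqP qe' e'e]].
    by rewrite /x eth qe.
  rewrite /x; case: ifP => // e'th; move/eqP: e'e; case.
  by apply: (fibration_inj e'th eth); rewrite qe.
have xP : x \in @realization_set R _ E.
  apply/mem_set; split.
  - by move=> e; rewrite /x; case: ifP => // _; exact: realization_ge0.
  - rewrite -(realization_sum1 z) (partition_big q xpredT) //=.
    by apply: eq_bigr => k _; exact: push.
  - move=> e e'; rewrite /x; case: ifP; rewrite ?eqxx // => eth ze.
    case: ifP; rewrite ?eqxx // => eth' ze'.
    by case/orP: (realization_chain ze ze') => h; apply/orP;
      [left; apply: q_refl eth eth' h|right; apply: q_refl eth' eth h].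
exists (exist _ x xP); apply/val_inj/funext => k.
by rewrite realization_mapE push.
Qed.

Lemma realization_map_fibre_top (x : realization R E) th :
  (forall e, val x e != 0 -> (e <= th)%O) ->
  forall e, val x e = if (e <= th)%O then val (realization_map q x) (q e) else 0.
Proof.
move=> top e; case: ifPn => [eth|]; last first.
  by move=> h; apply/eqP; apply: contraNT h; exact: top.
rewrite realization_mapE (bigD1 e) //= big1 ?addr0 // => e' /andP[/eqP qe e'e].
apply/eqP; apply: contraNT e'e => /top e'th; apply/eqP.
exact: (fibration_inj e'th eth).
Qed.

(** The bounds are the tops of the two supports; both are sent to the top of the support of the
    common image. *)
Lemma realization_map_fibre (x y : realization R E) :
  realization_map q x = realization_map q y ->
  exists th th', [/\ forall e, val x e != 0 -> (e <= th)%O,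
    forall e, val y e != 0 -> (e <= th')%O & q th = q th'].
Proof.
move=> xy; have [th xth top] := realization_top x.
have [th' yth' top'] := realization_top y; exists th, th'; split=> //.
have key (u v : realization R E) s s' : val u s != 0 ->
    (forall e, val v e != 0 -> (e <= s')%O) ->
    realization_map q u = realization_map q v -> (q s <= q s')%O.
  move=> us vtop uv.
  have : val (realization_map q u) (q s) != 0.
    rewrite realization_mapE (bigD1 s) //= gt_eqF //.
    apply: ltr_wpDr; first by apply: sumr_ge0 => i _; exact: realization_ge0.
    by rewrite lt_neqAle eq_sym us realization_ge0.
  rewrite uv realization_mapE => /eqP/psumr_neq0P[e _|e]; first exact: realization_ge0.
  by move=> /andP[/eqP <- ve]; apply/omorph_le/vtop; rewrite gt_eqF.
apply/eqP; rewrite eq_le; apply/andP; split.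
  exact: key xth top' xy.
exact: key yth' top (esym xy).
Qed.

End Fibration.

(** * The comparison map *)

Local Open Scope quotient_scope.

Section BalancedSpaceTheory.
Variables (gT : finGroupType) (X Y : topologicalType).
Variables (r : {action gT &-> X}) (l : left_action gT Y).

Definition balanced_pi (p : X * Y) : balanced_space r l := balanced_space_pi r l p.1 p.2.

Lemma balanced_pi_continuous : continuous balanced_pi.
Proof.
have -> : balanced_pi = \pi_(balanced_space r l) by apply/funext => -[].
exact: pi_continuous.
Qed.

Lemma balanced_pi_eq p p' :
  balanced_pi p = balanced_pi p' <-> exists a, p.1 = r p'.1 a /\ p'.2 = l a p.2.
Proof.
case: p p' => x y [x' y'].
split=> [/eqmodP/existsP[a /andP[/eqP ? /eqP ?]]|[a [h1 h2]]]; first by exists a.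
by apply/eqmodP/existsP; exists a; rewrite h1 h2 !eqxx.
Qed.

Lemma balanced_pi_act a x y : balanced_pi (r x a, y) = balanced_pi (x, l a y).
Proof. by apply/balanced_pi_eq; exists a. Qed.

Lemma balanced_pi_repr (c : balanced_space r l) : balanced_pi (repr c) = c.
Proof. by rewrite /balanced_pi /balanced_space_pi -surjective_pairing; exact: reprK. Qed.

Lemma balanced_continuous (Z : topologicalType) (f : balanced_space r l -> Z) :
  continuous (fun p => f (balanced_pi p)) -> continuous f.
Proof.
move=> fc; apply/quotient_continuous.
by have -> : f \o \pi_(balanced_space r l) = fun p => f (balanced_pi p)
  by apply/funext => -[].
Qed.

Hypothesis rc : forall a, continuous (r ^~ a).
Hypothesis lc : forall a, continuous (l a).

(** The preimage of the image of [O] is the union of the translates of [O]. *)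
Lemma balanced_pi_open (O : set (X * Y)) : open O -> open (balanced_pi @` O).
Proof.
move=> oO; pose act a (p : X * Y) := (r p.1 a, l a^-1%g p.2).
have actc a : continuous (act a).
  move=> p; have h1 : {for p, continuous (fun p : X * Y => r p.1 a)}.
    by apply: (@continuous_comp _ _ _ fst (r ^~ a)); [exact: cvg_fst|exact: rc].
  have h2 : {for p, continuous (fun p : X * Y => l a^-1%g p.2)}.
    by apply: (@continuous_comp _ _ _ snd (l a^-1%g)); [exact: cvg_snd|exact: lc].
  exact: (cvg_pair h1 h2).
have -> : open (balanced_pi @` O) = open (balanced_pi @^-1` (balanced_pi @` O)).
  have -> // : balanced_pi = \pi_(balanced_space r l) by apply/funext => -[].
rewrite (_ : _ @^-1` _ = \bigcup_(a in [set: gT]) (act a @^-1` O)).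
  by apply: bigcup_open => a _; apply: open_comp => // p _; exact: actc.
apply/seteqP; split=> [[x y] [[x' y'] Oxy /balanced_pi_eq[a [/= h1 h2]]]|[x y] [a _ Oa]].
  by exists a => //; rewrite /act /= h2 -lactM mulVg lact1 -h1.
exists (act a (x, y)) => //; apply/balanced_pi_eq; exists a => /=.
by rewrite -lactM mulgV lact1.
Qed.

(** A quotient map times the identity of [S] need not be a quotient map; openness of [balanced_pi]
    is what makes the descent work. *)
Lemma balanced_homotopy_continuous (S Z : topologicalType)
    (f : balanced_space r l * S -> Z) :
  continuous (fun p : (X * Y) * S => f (balanced_pi p.1, p.2)) -> continuous f.
Proof.
move=> fc [c s] U fU; rewrite -(balanced_pi_repr c) in fU *.
have [[W V] [/= nW nV] sub] := fc (repr c, s) _ fU.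
have nB : nbhs (balanced_pi (repr c)) (balanced_pi @` W).
  rewrite nbhsE in nW; have [O [oO Oc] OW] := nW.
  rewrite nbhsE; exists (balanced_pi @` O); last exact: image_subset.
  by split; [exact: balanced_pi_open|exists (repr c)].
by exists (balanced_pi @` W, V) => // -[b s'] /= [[p Wp <-] Vs']; exact: (sub (p, s')).
Qed.
End BalancedSpaceTheory.

Lemma homotopic_eq (R : realType) (X Y : topologicalType) (f f' g g' : X -> Y) :
  f =1 f' -> g =1 g' -> homotopic R f g -> homotopic R f' g'.
Proof. by move=> /funext -> /funext ->. Qed.

Lemma homotopic_refl (R : realType) (X Y : topologicalType) (f : X -> Y) :
  continuous f -> homotopic R f f.
Proof.
move=> fc; exists (f \o fst); split=> //; apply: continuous_subspaceT => z.
by apply: continuous_comp; [exact: cvg_fst|exact: fc].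
Qed.

Lemma spanning_tree_connect (G : graph) (e : rel G) (g g' : G) :
  spanning_tree e -> connect (@adj G) g g'.
Proof.
move=> [[_ _ eadj] [_ econn _]].
by apply: (connect_sub _ (econn g g')) => u v /eadj; exact: connect1.
Qed.

Section Comparison.
Variables (R : realType) (gT : finGroupType) (G : graph).
Variables (T : right_graph gT) (H : left_graph gT).

Local Notation E := (hom G (gprod T H)).
Local Notation K := (hom G (gbalanced T H)).
Local Notation bal := (hom_balanced_space R G T H).
Local Notation pi := (@balanced_pi gT (hom_space R G T) (hom_space R G H)
  (realization_ract R (hom_rposet G T)) (realization_lact R (hom_lposet G H))).

Definition hom_mul (f : hom G T) (h : hom G H) : K := hom_pi T H G (hom_prod f h).

Lemma hom_mul_le f f' h h' :
  (f <= f')%O -> (h <= h')%O -> (hom_mul f h <= hom_mul f' h')%O.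
Proof. by move=> ff hh; apply/omorph_le/hom_prod_le. Qed.

Definition comparison (c : bal) : hom_space R G (gbalanced T H) :=
  join hom_mul_le (repr c).1 (repr c).2.

(** Independence of representatives: by naturality both sides are the join along the single map
    sending [f], [h] to [hom_mul (hom_ract_fun f a) h]. *)
Lemma join_act (x : hom_space R G T) (y : hom_space R G H) a :
  join hom_mul_le (realization_ract R (hom_rposet G T) x a) y =
  join hom_mul_le x (realization_lact R (hom_lposet G H) a y).
Proof.
have mulP f f' h h' : (f <= f')%O -> (h <= h')%O ->
    (hom_mul (hom_ract_fun f a) h <= hom_mul (hom_ract_fun f' a) h')%O.
  by move=> ff hh; apply: hom_mul_le => //; exact: hom_map_le.
transitivity (join mulP x y).
  rewrite -[RHS](realization_map_id (f := id_omorphism K)) //.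
  rewrite (@join_natural R _ _ _ _ _ _ _ _ _ _ _ _ _ mulP hom_mul hom_mul_le
    (@rposet_map gT (hom_rposet G T) a : {omorphism hom_rposet G T -> hom_rposet G T})
    (id_omorphism (hom G H)) (id_omorphism K)) //.
  by rewrite (realization_map_id (f := id_omorphism (hom G H))).
rewrite -[LHS](realization_map_id (f := id_omorphism K)) //.
rewrite (@join_natural R _ _ _ _ _ _ _ _ _ _ _ _ _ mulP hom_mul hom_mul_le
  (id_omorphism (hom G T))
  (@lposet_map gT (hom_lposet G H) a : {omorphism hom_lposet G H -> hom_lposet G H})
  (id_omorphism K)) //.
  by rewrite (realization_map_id (f := id_omorphism (hom G T))).
by move=> f h /=; exact: hom_pi_prod_act.
Qed.

Lemma comparison_pi p : comparison (pi p) = join hom_mul_le p.1 p.2.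
Proof.
have /balanced_pi_eq[a [h1 h2]] := balanced_pi_repr (pi p).
by rewrite /comparison h1 h2 join_act.
Qed.

Lemma comparison_continuous : continuous comparison.
Proof.
apply: balanced_continuous.
have -> : (fun p => comparison (pi p)) = (fun p => join hom_mul_le p.1 p.2).
  by apply/funext => p; exact: comparison_pi.
exact: join_continuous.
Qed.

Section Lifting.
Variables (m d : nat) (e : rel G).
Hypothesis Hm : discontinuous m H.
Hypotheses (m5 : (5 <= m)%N) (md : (d + 2 <= m)%N).
Hypothesis neighbour : forall g : G, exists g', adj g g'.
Hypotheses (eT : spanning_tree e) (eD : is_diam e d).

Local Notation q := (hom_pi T H G).
Local Notation p := (realization_map (R := R) q).

Let q_surj := hom_pi_surj Hm m5 neighbour md eT eD (T := T).
Let q_lift := @hom_pi_lift gT T H G.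
Let q_refl := hom_pi_reflect_le Hm m5 neighbour (T := T).
Let p_surj := @realization_map_surj R _ _ _ _ _ q_surj q_lift q_refl.

Let root : G.
Proof. by have [_ [/card_gt0P/sigW[]]] := eT. Qed.

Let q_fibre := hom_pi_fibre Hm m5 neighbour
  (fun g g' => spanning_tree_connect g g' eT) root (T := T).

Definition split_pi (x : realization R E) : bal :=
  pi (realization_map (hom_fst T H G) x, realization_map (hom_snd T H G) x).

Lemma split_pi_continuous : continuous split_pi.
Proof.
move=> x; apply: (@continuous_comp _ _ _ (fun x : realization R E =>
  (realization_map (hom_fst T H G) x, realization_map (hom_snd T H G) x)) pi).
  exact: (cvg_pair (@realization_map_continuous R _ _ _ _ (hom_fst T H G) x)
    (@realization_map_continuous R _ _ _ _ (hom_snd T H G) x)).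
exact: balanced_pi_continuous.
Qed.

Lemma split_pi_diag a x : split_pi (realization_map (hom_diag T H G a) x) = split_pi x.
Proof.
have rE : realization_map (hom_fst T H G) (realization_map (hom_diag T H G a) x) =
    realization_ract R (hom_rposet G T) (realization_map (hom_fst T H G) x) a^-1%g.
  have h1 := @realization_map_comp R _ _ _ _ _ _ (hom_diag T H G a) (hom_fst T H G)
    (hom_fst T H G \o hom_diag T H G a) (fun _ => erefl) x.
  have h2 := @realization_map_comp R _ _ _ _ _ _ (hom_fst T H G)
    (@rposet_map gT (hom_rposet G T) a^-1%g : {omorphism hom_rposet G T -> hom_rposet G T})
    (hom_fst T H G \o hom_diag T H G a) (hom_fst_diag a) x.
  by rewrite -[LHS]h1 h2.
have lE : realization_map (hom_snd T H G) (realization_map (hom_diag T H G a) x) =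
    realization_lact R (hom_lposet G H) a (realization_map (hom_snd T H G) x).
  have h1 := @realization_map_comp R _ _ _ _ _ _ (hom_diag T H G a) (hom_snd T H G)
    (hom_snd T H G \o hom_diag T H G a) (fun _ => erefl) x.
  have h2 := @realization_map_comp R _ _ _ _ _ _ (hom_snd T H G)
    (@lposet_map gT (hom_lposet G H) a : {omorphism hom_lposet G H -> hom_lposet G H})
    (hom_snd T H G \o hom_diag T H G a) (hom_snd_diag a) x.
  by rewrite -[LHS]h1 h2.
rewrite /split_pi rE lE balanced_pi_act -lactM.
by rewrite mulVg lact1.
Qed.

(** A group element carries the bound [th] to [th']. The translate of [x] and the point [y] then lie
    below the same [th'] with the same image, hence coincide, and [split_pi] ignores
    translations. *)
Lemma split_pi_fibre x y : p x = p y -> split_pi x = split_pi y.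
Proof.
move=> xy; have [th [th' [top top' thth']]] := realization_map_fibre xy.
have [a tha] := q_fibre thth'.
rewrite -(split_pi_diag a); congr split_pi.
have pa : p (realization_map (hom_diag T H G a) x) = p y.
  rewrite -xy; apply/esym; apply: realization_map_comp => f.
  by rewrite /= hom_pi_diag.
have topa f : val (realization_map (hom_diag T H G a) x) f != 0%R -> (f <= th')%O.
  rewrite realization_mapE => /eqP/psumr_neq0P[f' _|f' /andP[/eqP<- xf']].
    exact: realization_ge0.
  by rewrite tha; apply/omorph_le/top; rewrite gt_eqF.
apply/val_inj/funext => f.
by rewrite (realization_map_fibre_top q_refl topa)
  (realization_map_fibre_top q_refl top') pa.
Qed.

(** The lift is an arbitrary choice with no continuity of its own; since [split_pi] is constant on
    fibres, continuity comes from [continuous_descent]. *)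
Definition inv_comparison (z : hom_space R G (gbalanced T H)) : bal :=
  split_pi (sval (cid (p_surj z))).

Lemma inv_comparison_pi x : inv_comparison (p x) = split_pi x.
Proof. by apply: split_pi_fibre; case: cid. Qed.

Lemma inv_comparison_continuous : continuous inv_comparison.
Proof.
apply: (continuous_descent (@realization_compact R _ E)
  (@realization_hausdorff R _ K) _ split_pi_continuous p_surj inv_comparison_pi).
exact: realization_map_continuous.
Qed.

Lemma inv_comparisonK : cancel comparison inv_comparison.
Proof.
move=> c; rewrite -(balanced_pi_repr c); case: (repr c) => x y.
pose j := @join R _ _ _ _ _ _ (@hom_prod gT T H G) (@hom_prod_le gT T H G) x y.
have -> : comparison (pi (x, y)) = p j.
  rewrite comparison_pi (@join_natural R _ _ _ _ _ _ _ _ _ _ _ _ _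
    (@hom_prod_le gT T H G) hom_mul hom_mul_le
    (id_omorphism (hom G T)) (id_omorphism (hom G H)) q) //.
  by rewrite !realization_map_id.
rewrite inv_comparison_pi /split_pi.
rewrite (@join_marginal1 _ _ _ _ _ _ _ _ _ (hom_fst T H G)); last exact: hom_fst_prod.
by rewrite (@join_marginal2 _ _ _ _ _ _ _ _ _ (hom_snd T H G)) //; exact: hom_snd_prod.
Qed.

Let lift (k : K) : E := sval (cid (q_surj k)).

(** Enlarges a lift to the product of its projections and maps it back down; this is the poset map
    that induces [comparison \o inv_comparison]. *)
Definition saturate (k : K) : K :=
  hom_mul (hom_fst T H G (lift k)) (hom_snd T H G (lift k)).

Lemma saturate_pi f : saturate (q f) = hom_mul (hom_fst T H G f) (hom_snd T H G f).
Proof.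
rewrite /saturate /lift; case: cid => f' /= /q_fibre[a ->].
rewrite [hom_fst _ _ _ (hom_diag _ _ _ _ _)]hom_fst_diag.
rewrite [hom_snd _ _ _ (hom_diag _ _ _ _ _)]hom_snd_diag.
by rewrite /hom_mul hom_pi_prod_act -[hom_lact_fun _ _](hom_lactM) mulVg hom_lact1.
Qed.

Lemma le_saturate k : (k <= saturate k)%O.
Proof.
have [f <-] := q_surj k; rewrite saturate_pi.
exact/omorph_le/le_hom_prod.
Qed.

Lemma saturate_le k k' : (k <= k')%O -> (saturate k <= saturate k')%O.
Proof.
(* The lift of [k] is taken below that of [k'], which [saturate_pi] permits since any lift computes
   [saturate]. *)
have [f' <-] := q_surj k' => /q_lift[f ff' <-]; rewrite !saturate_pi.
by apply: hom_mul_le; exact: omorph_le.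
Qed.

Lemma comparison_equivalence_lifting : homotopy_equivalence R comparison.
Proof.
split; first exact: comparison_continuous.
exists inv_comparison; split; first exact: inv_comparison_continuous.
  apply: (@homotopic_eq _ _ _ id _ id) => //.
    by move=> c /=; rewrite inv_comparisonK.
  by apply: homotopic_refl => ?; exact: cvg_id.
apply: homotopic_eq (@poset_homotopy R _ _ _ _ (id_omorphism K)
  (mk_omorphism saturate_le) le_saturate) => z; last exact: realization_map_id.
have [x <-] := p_surj z; rewrite /= inv_comparison_pi comparison_pi /=.
rewrite (@join_diag _ _ _ _ _ _ _ _ hom_mul_le _ _ _ _ (mk_omorphism saturate_le \o q)).
  by apply/esym; exact: realization_map_comp.
by move=> f /=; exact: saturate_pi.
Qed.

End Lifting.
End Comparison.

(** * Contraction onto a greatest element, and graphs without edges *)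

Section Vertex.
Variables (R : realType) (d : Order.disp_t) (Q : finPOrderType d).

Definition vertex (m : Q) : realization R Q :=
  realization_map (const_omorphism bool m) (interval_point 0%R).

Lemma realization_map_const d' (Q' : finPOrderType d') (m : Q) (x : realization R Q') :
  realization_map (const_omorphism Q' m) x = vertex m.
Proof.
have constE d1 (Q1 : finPOrderType d1) (z : realization R Q1) c :
    val (realization_map (const_omorphism Q1 m) z) c = ((m == c)%:R)%R.
  rewrite realization_mapE; have [mc|mc] := eqVneq m c.
    by rewrite -(realization_sum1 z); apply: eq_bigl => q; apply/eqP.
  by rewrite big_pred0 // => q; apply/negbTE.
by apply/val_inj/funext => c; rewrite !constE.
Qed.

Variable m : Q.
Hypothesis mtop : forall q, (q <= m)%O.

Definition cone_mul (q : Q) (b : bool) : Q := if b then m else q.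

Lemma cone_mul_le q q' b b' :
  (q <= q')%O -> (b <= b')%O -> (cone_mul q b <= cone_mul q' b')%O.
Proof. by case: b; case: b'. Qed.

(* Contracts [|Q|] onto the vertex [m], which is reached at time [0]. *)
Definition contract (x : realization R Q) (t : R) : realization R Q :=
  join cone_mul_le x (interval_point t).

Lemma contract0 x : contract x 0%R = vertex m.
Proof.
rewrite /contract (interval_point_vertex true x).
rewrite -{1}[x](realization_map_id (f := id_omorphism Q)) //.
rewrite (@join_diag _ _ _ _ _ _ _ _ cone_mul_le _ _ _ _ (const_omorphism Q m)) //.
exact: realization_map_const.
Qed.

Lemma contract1 x : contract x 1%R = x.
Proof.
rewrite /contract (interval_point_vertex false x).
rewrite -{1}[x](realization_map_id (f := id_omorphism Q)) //.
rewrite (@join_diag _ _ _ _ _ _ _ _ cone_mul_le _ _ _ _ (id_omorphism Q)) //.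
exact: realization_map_id.
Qed.

Lemma contract_map (f : {omorphism Q -> Q}) x t :
  f m = m -> realization_map f (contract x t) = contract (realization_map f x) t.
Proof.
move=> fm; rewrite /contract -{2}[interval_point t](realization_map_id
  (f := id_omorphism bool)) //.
by apply: join_natural => q [].
Qed.

Lemma contract_continuous : continuous (fun z : realization R Q * R => contract z.1 z.2).
Proof.
move=> z; apply: (@continuous_comp _ _ _ (fun z : realization R Q * R =>
  (z.1, interval_point z.2)) (fun p => join cone_mul_le p.1 p.2)).
  have ic : {for z, continuous (fun z : realization R Q * R => interval_point z.2)}.
    apply: (@continuous_comp _ _ _ snd (@interval_point R)); first exact: cvg_snd.
    exact: interval_point_continuous.
  exact: (cvg_pair cvg_fst ic).
exact: join_continuous.
Qed.

End Vertex.

Section FullHom.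
Variables (G H : graph).
Hypothesis no_edge : forall g g' : G, adj g g' = false.
Variable y : H.

Lemma full_is_multihom : is_multihom (H := H) [ffun _ : G => [set: H]%SET].
Proof.
apply/andP; split; apply/forallP => g;
  first by rewrite ffunE; apply/finset.set0Pn; exists y.
by apply/forallP => g'; rewrite no_edge.
Qed.

Definition full_hom : hom G H := Defs.Hom full_is_multihom.

Lemma full_hom_top (f : hom G H) : (f <= full_hom)%O.
Proof. by apply/hom_leP => g; rewrite ffunE finset.subsetT. Qed.

End FullHom.

Lemma top_fixed d (Q : finPOrderType d) (m : Q) (f f' : {omorphism Q -> Q}) :
  (forall q, (q <= m)%O) -> cancel f' f -> f m = m.
Proof.
move=> mtop ff'; apply/le_anti; rewrite mtop /=.
by rewrite -{1}(ff' m); apply: omorph_le.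
Qed.

Section Edgeless.
Variables (R : realType) (gT : finGroupType) (G : graph).
Variables (T : right_graph gT) (H : left_graph gT).
Hypothesis no_edge : forall g g' : G, adj g g' = false.

Local Notation K := (hom G (gbalanced T H)).
Local Notation bal := (hom_balanced_space R G T H).
Local Notation rA := (realization_ract R (hom_rposet G T)).
Local Notation lB := (realization_lact R (hom_lposet G H)).
Local Notation pi := (@balanced_pi gT (hom_space R G T) (hom_space R G H) rA lB).

(** The group acts by order automorphisms, which fix the greatest elements [mA] and [mB]. The two
    contractions are therefore equivariant and together descend to a contraction of the balanced
    product. *)
Lemma comparison_equivalence_inhabited (t : T) (y : H) :
  homotopy_equivalence R (@comparison R gT G T H).
Proof.
pose mA := full_hom no_edge t; pose mB := full_hom no_edge y.
have topA : forall f, (f <= mA)%O := full_hom_top no_edge t.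
have topB : forall f, (f <= mB)%O := full_hom_top no_edge y.
have topK (k : K) : (k <= hom_mul mA mB)%O.
  apply/hom_leP => g; apply/fintype.subsetP => c _.
  have [x <-] := gbalanced_pi_surj c; rewrite [hom_mul _ _ _]hom_piE; apply: imset_f.
  by rewrite ffunE inE !ffunE !inE.
pose base : bal := pi (vertex R mA, vertex R mB).
have fixA a : rposet_map (Q := hom_rposet G T) a mA = mA.
  apply: (@top_fixed _ (hom G T) mA
    (rposet_map a : {omorphism hom_rposet G T -> hom_rposet G T})
    (rposet_map a^-1%g : {omorphism hom_rposet G T -> hom_rposet G T})) => // f.
  by rewrite /= /rposet_map -ractM mulVg ract1.
have fixB a : lposet_map (Q := hom_lposet G H) a mB = mB.
  apply: (@top_fixed _ (hom G H) mB
    (lposet_map a : {omorphism hom_lposet G H -> hom_lposet G H})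
    (lposet_map a^-1%g : {omorphism hom_lposet G H -> hom_lposet G H})) => // f.
  by rewrite /= /lposet_map -lactM mulgV lact1.
have rc a : continuous (rA ^~ a).
  exact: (@realization_map_continuous R _ _ _ _
    (rposet_map a : {omorphism hom_rposet G T -> hom_rposet G T})).
have lc a : continuous (lB a).
  exact: (@realization_map_continuous R _ _ _ _
    (lposet_map a : {omorphism hom_lposet G H -> hom_lposet G H})).
split; first exact: comparison_continuous.
exists (fun=> base); split; first exact: cst_continuous.
  pose h (z : bal * R) : bal :=
    pi (contract topA (repr z.1).1 z.2, contract topB (repr z.1).2 z.2).
  have hE x x' s : h (pi (x, x'), s) = pi (contract topA x s, contract topB x' s).
    have /balanced_pi_eq[a [h1 h2]] := balanced_pi_repr (pi (x, x')).
    rewrite /h /= h1 -[x' in RHS]/((x, x').2) h2.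
    have -> : contract topA (rA x a) s = rA (contract topA x s) a.
      by apply/esym; apply: contract_map; exact: fixA.
    have -> : contract topB (lB a (repr (pi (x, x'))).2) s =
        lB a (contract topB (repr (pi (x, x'))).2 s).
      by apply/esym; apply: contract_map; exact: fixB.
    exact: balanced_pi_act.
  exists h; split.
  - apply: continuous_subspaceT; apply: (balanced_homotopy_continuous rc lc).
    have -> : (fun p => h (pi p.1, p.2)) =
        (fun p => pi (contract topA p.1.1 p.2, contract topB p.1.2 p.2)).
      by apply/funext => -[[x x'] s]; exact: hE.
    move=> p; apply: (@continuous_comp _ _ _
      (fun p : (hom_space R G T * hom_space R G H) * R =>
        (contract topA p.1.1 p.2, contract topB p.1.2 p.2)) pi); last first.
      exact: balanced_pi_continuous.
    have c1 : {for p, continuous (fun p : (hom_space R G T * hom_space R G H) * R =>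
        contract topA p.1.1 p.2)}.
      apply: (@continuous_comp _ _ _
        (fun p : (hom_space R G T * hom_space R G H) * R => (p.1.1, p.2))
        (fun z => contract topA z.1 z.2)); last exact: contract_continuous.
      have e1 : {for p, continuous
          (fun p : (hom_space R G T * hom_space R G H) * R => p.1.1)}.
        by apply: (@continuous_comp _ _ _ fst fst); exact: cvg_fst.
      exact: (cvg_pair e1 cvg_snd).
    have c2 : {for p, continuous (fun p : (hom_space R G T * hom_space R G H) * R =>
        contract topB p.1.2 p.2)}.
      apply: (@continuous_comp _ _ _
        (fun p : (hom_space R G T * hom_space R G H) * R => (p.1.2, p.2))
        (fun z => contract topB z.1 z.2)); last exact: contract_continuous.
      have e2 : {for p, continuous
          (fun p : (hom_space R G T * hom_space R G H) * R => p.1.2)}.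
        by apply: (@continuous_comp _ _ _ fst snd); [exact: cvg_fst|exact: cvg_snd].
      exact: (cvg_pair e2 cvg_snd).
    exact: (cvg_pair c1 c2).
  - by move=> c; rewrite -(balanced_pi_repr c); case: (repr c) => x x';
      rewrite hE !contract0.
  - by move=> c; rewrite -(balanced_pi_repr c); case: (repr c) => x x';
      rewrite hE !contract1.
apply: homotopic_eq (@poset_homotopy R _ _ _ _ (id_omorphism K)
  (const_omorphism K (hom_mul mA mB)) topK) => z; last exact: realization_map_id.
rewrite realization_map_const /= comparison_pi /=.
rewrite (@join_diag R _ _ _ _ _ _ _ (@hom_mul_le gT G T H) _ bool
  (const_omorphism bool mA) (const_omorphism bool mB)
  (const_omorphism bool (hom_mul mA mB))) //.
Qed.

(** Both spaces are empty, since a multihomomorphism has a nonempty value at [g]. *)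
Lemma comparison_equivalence_empty (g : G) :
  (T -> H -> False) -> homotopy_equivalence R (@comparison R gT G T H).
Proof.
move=> none.
have nobal : bal -> False.
  move=> c; have [f _ _] := realization_top (repr c).1.
  have [h _ _] := realization_top (repr c).2.
  have /finset.set0Pn[t _] := hom_neq0 f g.
  by have /finset.set0Pn[y _] := hom_neq0 h g; exact: none t y.
have noK : hom_space R G (gbalanced T H) -> False.
  move=> z; have [f _ _] := realization_top z.
  have /finset.set0Pn[c _] := hom_neq0 f g; have [x _] := gbalanced_pi_surj c.
  exact: none x.1 x.2.
split; first exact: comparison_continuous.
exists (fun z => False_rect _ (noK z)); split.
- by move=> z; case: (noK z).
- exists fst; split; [|by move=> c; case: (nobal c)..].
  by apply: continuous_subspaceT => -[c ?]; case: (nobal c).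
- exists fst; split; [|by move=> z; case: (noK z)..].
  by apply: continuous_subspaceT => -[z ?]; case: (noK z).
Qed.

Lemma comparison_equivalence_edgeless (g : G) :
  homotopy_equivalence R (@comparison R gT G T H).
Proof.
have [[t [y _]]|none] := pselect (exists (t : T) (y : H), True).
  exact: comparison_equivalence_inhabited t y.
by apply: (comparison_equivalence_empty g) => t y; apply: none; exists t, y.
Qed.

End Edgeless.

Lemma comparison_natural (R : realType) (gT : finGroupType) (G G' : graph)
    (T T' : right_graph gT) (H H' : left_graph gT) (u : ghom G' G) (v : rghom T T')
    (w : lghom H H') (x : hom_space R G T) (y : hom_space R G H) :
  hom_space_map u (gbalanced_map v w) (comparison (hom_balanced_pi x y)) =
  comparison (hom_balanced_pi (hom_space_map u v x) (hom_space_map u w y)).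
Proof.
have cE G0 (T0 : right_graph gT) (H0 : left_graph gT) x0 y0 :
    comparison (@hom_balanced_pi R gT G0 T0 H0 x0 y0) =
    join (@hom_mul_le gT G0 T0 H0) x0 y0 := comparison_pi (x0, y0).
rewrite !cE /hom_space_map; apply: join_natural => f h.
apply: hom_ext => g; rewrite ffunE !hom_piE !ffunE -imset_comp; apply/finset.setP => c.
apply/imsetP/imsetP => -[[t b]] /finset.setXP[/= tP bP ->].
  exists (v t, w b); last exact: gbalanced_funE.
  by rewrite inE /= !imset_f.
move: tP bP => /imsetP[t' t'f ->] /imsetP[b' b'h ->]; exists (t', b').
  by rewrite inE /= t'f.
by rewrite /= gbalanced_funE.
Qed.

Theorem theorem1p7 (R : realType) (gT : finGroupType) :
  exists Phi : forall (G : graph) (T : right_graph gT) (P : left_poset gT),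
      hom_balanced_space R G T (atom_graph P) ->
      hom_space R G (gbalanced T (atom_graph P)),
    (forall (G : graph) (T : right_graph gT) (P : left_poset gT) (d : nat),
       free_action (lposet_act P) ->
       min_spanning_diam G d ->
       discontinuous (maxn 5 (d + 2)) (atom_graph P) ->
       homotopy_equivalence R (Phi G T P))
    /\
    (forall (G G' : graph) (T T' : right_graph gT) (P P' : left_poset gT) (d d' : nat)
            (u : ghom G' G) (v : rghom T T')
            (w : lghom (atom_graph P) (atom_graph P')),
       free_action (lposet_act P) ->
       min_spanning_diam G d ->
       discontinuous (maxn 5 (d + 2)) (atom_graph P) ->
       free_action (lposet_act P') ->
       min_spanning_diam G' d' ->
       discontinuous (maxn 5 (d' + 2)) (atom_graph P') ->
       forall (x : hom_space R G T) (y : hom_space R G (atom_graph P)),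
         hom_space_map u (gbalanced_map v w) (Phi G T P (hom_balanced_pi x y)) =
         Phi G' T' P' (hom_balanced_pi (hom_space_map u v x) (hom_space_map u w y))).
Proof.
exists (fun G T P => @comparison R gT G T (atom_graph P)); split; last first.
  by move=> *; exact: comparison_natural.
move=> G T P d _ [[e eT eD] _] disc.
have [neighbour|] := pselect (forall g : G, exists g', adj g g').
  apply: (comparison_equivalence_lifting R T disc _ _ neighbour eT eD).
    exact: leq_maxl.
  exact: leq_maxr.
move=> /existsNP[g /forallNP ng]; apply: comparison_equivalence_edgeless (g).
(* A nontrivial path from [g] would start with an edge at [g]. *)
have single x : x = g.
  have /connectP[[|x' p] /= pp ->] := spanning_tree_connect g x eT => //.
  by case/andP: pp => /ng.
by move=> x x'; rewrite (single x) (single x'); apply/negP => /ng.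
Qed.
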